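(* Let $(R,\mathfrak m)$ be a Noetherian local ring, let $M\neq 0$ be a finitely generated $R$-module, and let $I\subsetneq R$ be an ideal. Let $c:=\operatorname{grade}(I,M)$. Then the following conditions are equivalent: (i) $H^i_I(M)=0$ for all $i\neq c$. (ii) The natural map $$H^i_{\mathfrak pR_{\mathfrak p}}\bigl(H^c_{IR_{\mathfrak p}}(M_{\mathfrak p})\bigr)\to H^{i+c}_{\mathfrak pR_{\mathfrak p}}(M_{\mathfrak p})$$ is an isomorphism for all $\mathfrak p\in V(I)\cap\operatorname{Supp} M$ and all $i\in\mathbb Z$.
   Context: $H^i_I$ denotes local cohomology, $\Gamma_I$ the $I$-torsion (section) functor, and $\operatorname{grade}(I,M)=\inf\{i: H^i_I(M)\neq 0\}$. The natural map is defined as follows. Let $(A,\mathfrak n)$ be a Noetherian local ring, $J\subsetneq A$ an ideal, $N$ a finitely generated $A$-module, and $c$ an integer with $c\le \operatorname{grade}(J,N)$. Let $E^{\cdot}_A(N)$ be a minimal injective resolution of $N$. Then $\Gamma_J(E^i_A(N))=0$ for $i<c$, so $H^c_J(N)=\operatorname{Ker}\bigl(\Gamma_J(E^c_A(N))\to\Gamma_J(E^{c+1}_A(N))\bigr)$ and there is an embedding of complexes $H^c_J(N)[-c]\to\Gamma_J(E^{\cdot}_A(N))$, where $H^c_J(N)[-c]$ is the module $H^c_J(N)$ placed in cohomological degree $c$. Applying the derived functor $\mathrm R\Gamma_{\mathfrak n}$, and using that $\mathrm R\Gamma_{\mathfrak n}(\Gamma_J(E^{\cdot}_A(N)))$ is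 represented by $\Gamma_{\mathfrak n}(\Gamma_J(E^{\cdot}_A(N)))=\Gamma_{\mathfrak n}(E^{\cdot}_A(N))$, one obtains on cohomology in degree $i+c$ the natural map $H^i_{\mathfrak n}(H^c_J(N))\to H^{i+c}_{\mathfrak n}(N)$. In (ii) this is applied with $A=R_{\mathfrak p}$, $\mathfrak n=\mathfrak pR_{\mathfrak p}$, $J=IR_{\mathfrak p}$, $N=M_{\mathfrak p}$ and the fixed integer $c=\operatorname{grade}(I,M)$ (note $c\le\operatorname{grade}(IR_{\mathfrak p},M_{\mathfrak p})$). *)

(* Defs.v *)
From HB Require Import structures.
From mathcomp Require Import all_boot all_order all_algebra.
From mathcomp Require Import generic_quotient ring_quotient.
From mathcomp Require Import boolp ring.

Set Implicit Arguments.
Unset Strict Implicit.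
Unset Printing Implicit Defensive.

Import Order.TTheory GRing.Theory Num.Theory.
Local Open Scope ring_scope.
Local Open Scope quotient_scope.

Definition choose_or (T : Type) (x0 : T) (P : T -> Prop) : T :=
  if pselect (exists x, P x) is left exP then projT1 (cid exP) else x0.

(* In MathComp an [idealr R] is a proper ideal and a [prime_idealr R] a
   (proper) prime ideal; both are boolean predicates, which classically loses
   no generality. *)

Definition is_zero (R : nzRingType) (M : lmodType R) : Prop :=
  forall x : M, x = 0.

Definition generates (R : nzRingType) (M : lmodType R) (n : nat)
    (g : 'I_n -> M) (S : {pred M}) : Prop :=
  forall x, x \in S <-> exists a : 'I_n -> R, x = \sum_k a k *: g k.

Definition finitely_generated (R : nzRingType) (M : lmodType R) : Prop :=
  exists n (g : 'I_n -> M), generates g predT.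

(* The submodules of [R^o] are the ideals of [R], the unit ideal included. *)
Definition noetherian (R : comNzRingType) : Prop :=
  forall S : submodClosed R^o, exists n (g : 'I_n -> R^o), generates g S.

Definition maximal_ideal (R : comNzRingType) (m : idealr R) : Prop :=
  forall J : idealr R, {subset m <= J} -> J =i m.

Definition local_ring (R : comNzRingType) (m : idealr R) : Prop :=
  maximal_ideal m /\ forall m' : idealr R, maximal_ideal m' -> m' =i m.

Section Submodule.
Variables (R : nzRingType) (M : lmodType R) (S : submodClosed M).

Definition submod : Type := {x : M | x \in S}.

HB.instance Definition _ := SubChoice.on submod.
HB.instance Definition _ :=
  GRing.SubChoice_isSubLmodule.Build R M (fun x => x \in S) submod
    (GRing.subsemimodClosedP S).
End Submodule.

Section QuotientModule.
Variables (R : nzRingType) (M : lmodType R) (S : submodClosed M).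

(* A bare [submodClosed] is not known to be closed under opposites, which
   [Quotient.quot] requires; its membership predicate can be registered so. *)
Definition quot_pred : {pred M} := fun x => x \in S.

HB.instance Definition _ := GRing.isSubmodClosed.Build R M quot_pred
  (GRing.subsemimodClosedP S).

Definition quotmod : Type := Quotient.quot quot_pred.

HB.instance Definition _ := GRing.Zmodule.on quotmod.

Definition quotmod_class (x : M) : quotmod := \pi_(Quotient.quot quot_pred) x.
Definition quotmod_repr (X : quotmod) : M := repr (X : Quotient.quot quot_pred).

Lemma quotmod_reprK : cancel quotmod_repr quotmod_class.
Proof. exact: reprK. Qed.

Lemma quotmod_classP x y : quotmod_class x = quotmod_class y <-> x - y \in S.
Proof.
split=> [/eqP|h]; first by rewrite -Quotient.idealrBE.
by apply/eqP; rewrite -Quotient.idealrBE.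
Qed.

Lemma quotmod_classD : {morph quotmod_class : x y / x + y}.
Proof. exact: (raddfD (\pi_(Quotient.quot quot_pred))). Qed.

Definition quotmod_scale (a : R) (X : quotmod) : quotmod :=
  quotmod_class (a *: quotmod_repr X).

Lemma quotmod_class_scale a x :
  quotmod_scale a (quotmod_class x) = quotmod_class (a *: x).
Proof.
apply/quotmod_classP; rewrite -scalerBr; apply: rpredZ.
by apply/quotmod_classP; rewrite quotmod_reprK.
Qed.

Lemma quotmod_scaleA a b X :
  quotmod_scale a (quotmod_scale b X) = quotmod_scale (a * b) X.
Proof.
by rewrite -[X]quotmod_reprK !quotmod_class_scale scalerA.
Qed.

Lemma quotmod_scale1 : left_id 1 quotmod_scale.
Proof.
by move=> X; rewrite -[X]quotmod_reprK quotmod_class_scale scale1r.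
Qed.

Lemma quotmod_scaleDr : right_distributive quotmod_scale +%R.
Proof.
move=> a X Y; rewrite -[X]quotmod_reprK -[Y]quotmod_reprK.
by rewrite -quotmod_classD !quotmod_class_scale scalerDr quotmod_classD.
Qed.

Lemma quotmod_scaleDl X : {morph quotmod_scale^~ X : a b / a + b}.
Proof.
move=> a b; rewrite -[X]quotmod_reprK !quotmod_class_scale scalerDl.
exact: quotmod_classD.
Qed.

HB.instance Definition _ := GRing.Zmodule_isLmodule.Build R quotmod
  quotmod_scaleA quotmod_scale1 quotmod_scaleDr quotmod_scaleDl.

Lemma quotmod_class_is_linear : linear quotmod_class.
Proof. by move=> a x y; rewrite quotmod_classD -quotmod_class_scale. Qed.

HB.instance Definition _ :=
  GRing.isLinear.Build R M quotmod _ quotmod_class quotmod_class_is_linear.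
End QuotientModule.

Section InducedMaps.
Variables (R : nzRingType) (U V : lmodType R) (f : {linear U -> V}).
Variables (S : submodClosed U) (T : submodClosed V).
Hypothesis fST : forall x, x \in S -> f x \in T.

Definition submod_map_fun (x : submod S) : submod T :=
  exist _ (f (val x)) (fST (valP x)).

Lemma submod_map_is_linear : linear submod_map_fun.
Proof. by move=> a x y; apply: val_inj; rewrite /= linearP. Qed.

HB.instance Definition _ := GRing.isLinear.Build R (submod S) (submod T) _
  submod_map_fun submod_map_is_linear.

Definition submod_map : {linear submod S -> submod T} := submod_map_fun.

Definition quotmod_map_fun (X : quotmod S) : quotmod T :=
  quotmod_class T (f (quotmod_repr X)).

Lemma quotmod_map_class x :
  quotmod_map_fun (quotmod_class S x) = quotmod_class T (f x).
Proof.
apply/quotmod_classP; rewrite -linearB; apply: fST.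
by apply/quotmod_classP; rewrite quotmod_reprK.
Qed.

Lemma quotmod_map_is_linear : linear quotmod_map_fun.
Proof.
move=> a X Y; rewrite -[X]quotmod_reprK -[Y]quotmod_reprK -linearP.
by rewrite !quotmod_map_class !linearP.
Qed.

HB.instance Definition _ := GRing.isLinear.Build R (quotmod S) (quotmod T) _
  quotmod_map_fun quotmod_map_is_linear.

Definition quotmod_map : {linear quotmod S -> quotmod T} := quotmod_map_fun.
End InducedMaps.

Section KernelImage.
Variables (R : nzRingType) (U V : lmodType R) (f : {linear U -> V}).

Definition ker_pred : {pred U} := fun x => f x == 0.

Lemma in_ker x : (x \in ker_pred) = (f x == 0). Proof. by []. Qed.

Lemma ker_pred_closed : subsemimod_closed ker_pred.
Proof.
split; first split.
- by rewrite in_ker linear0.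
- by move=> x y; rewrite !in_ker linearD => /eqP-> /eqP->; rewrite addr0.
- by move=> a x; rewrite !in_ker linearZZ => /eqP->; rewrite scaler0.
Qed.

HB.instance Definition _ := GRing.isSubmodClosed.Build R U ker_pred
  ker_pred_closed.

Definition im_pred : {pred V} := fun y => `[< exists x, f x = y >].

Lemma im_pred_closed : subsemimod_closed im_pred.
Proof.
split; first split.
- by apply/asboolP; exists 0; rewrite linear0.
- move=> _ _ /asboolP[x <-] /asboolP[y <-].
  by apply/asboolP; exists (x + y); rewrite linearD.
- move=> a _ /asboolP[x <-].
  by apply/asboolP; exists (a *: x); rewrite linearZZ.
Qed.

HB.instance Definition _ := GRing.isSubmodClosed.Build R V im_pred
  im_pred_closed.
End KernelImage.

(* The part of a submodule [T] of [M] that lies in the submodule [S]. *)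
Section Restriction.
Variables (R : nzRingType) (M : lmodType R) (S T : submodClosed M).

Definition restr_pred : {pred submod S} := fun x => val x \in T.

Lemma in_restr x : (x \in restr_pred) = (val x \in T). Proof. by []. Qed.

Lemma restr_pred_closed : subsemimod_closed restr_pred.
Proof.
split; first split.
- by rewrite in_restr rpred0.
- by move=> x y; rewrite !in_restr; apply: rpredD.
- by move=> a x; rewrite !in_restr; apply: rpredZ.
Qed.

HB.instance Definition _ := GRing.isSubmodClosed.Build R (submod S) restr_pred
  restr_pred_closed.
End Restriction.
Arguments restr_pred {R M} S T.

(* The differential is given as a family over all pairs of degrees which
   vanishes outside the pairs (i, i + 1); this avoids transports along
   equalities between degrees. *)
Record complex (R : comNzRingType) := Complex {
  obj :> int -> lmodType R;
  diff : forall i j, {linear obj i -> obj j};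
  diff_shape : forall i j, j != i + 1 -> forall x, diff i j x = 0;
  diff_comp : forall i j k x, diff j k (diff i j x) = 0
}.

(* A family of maps [C i -> D (i + c)] commuting with the differentials, i.e.
   a morphism of complexes from C to D[c] (no sign is put on the differential
   of D[c]), again given over all pairs of degrees. *)
Record cmap (R : comNzRingType) (c : int) (C D : complex R) := CMap {
  cmap_fun :> forall i j, {linear C i -> D j};
  cmap_shape : forall i j, j != i + c -> forall x, cmap_fun i j x = 0;
  cmap_comm : forall i (x : C i),
    cmap_fun (i + 1) (i + 1 + c) (diff C i (i + 1) x) =
    diff D (i + c) (i + 1 + c) (cmap_fun i (i + c) x)
}.

Section Cohomology.
Variables (R : comNzRingType).

Section Objects.
Variables (C : complex R) (i : int).

Definition cocycles : submodClosed (C i) := ker_pred (diff C i (i + 1)).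

Definition coboundaries : submodClosed (submod cocycles) :=
  restr_pred cocycles (im_pred (diff C (i - 1) i)).

Definition cohomology : lmodType R := quotmod coboundaries.
End Objects.

Variables (c : int) (C D : complex R) (f : cmap c C D) (i : int).

Lemma cmap_cocycles x :
  x \in cocycles C i -> f i (i + c) x \in cocycles D (i + c).
Proof.
rewrite !in_ker => /eqP dx0; rewrite addrAC.
by rewrite -cmap_comm dx0 linear0.
Qed.

Definition cocycles_map := submod_map cmap_cocycles.

Lemma cmap_coboundaries x :
  x \in coboundaries C i -> cocycles_map x \in coboundaries D (i + c).
Proof.
move=> /asboolP[y dy]; apply/asboolP => /=; rewrite -dy addrAC.
have e : i = i - 1 + 1 by rewrite subrK.
exists (f (i - 1) (i - 1 + c) y).
by move: (i - 1) e y {x dy} => k -> y; rewrite cmap_comm.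
Qed.

Definition cohomology_map : {linear cohomology C i -> cohomology D (i + c)} :=
  quotmod_map cmap_coboundaries.
End Cohomology.

Definition injective_module (R : comNzRingType) (E : lmodType R) : Prop :=
  forall (A B : lmodType R) (f : {linear A -> B}) (g : {linear A -> E}),
    injective f -> exists h : {linear B -> E}, forall x, h (f x) = g x.

Definition essential (R : comNzRingType) (M : lmodType R)
    (K : submodClosed M) : Prop :=
  forall S : submodClosed M, (exists2 x, x \in S & x != 0) ->
    exists x, [/\ x \in S, x \in K & x != 0].

Record augmented (R : comNzRingType) (N : lmodType R) := Augmented {
  aug_complex :> complex R;
  aug : {linear N -> aug_complex 0}
}.

Definition injective_resolution (R : comNzRingType) (N : lmodType R)
    (E : augmented N) : Prop :=
  [/\ forall i, injective_module (E i),
      forall i : int, i < 0 -> is_zero (E i),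
      injective (aug E),
      forall x : E 0, diff E 0 1 x = 0 <-> exists n, aug E n = x
    & forall i : int, 0 < i -> is_zero (cohomology E i)].

(* Minimality: each [E i] is an injective hull of the kernel of its
   differential; in degree 0 this kernel is the image of [N]. *)
Definition minimal_injective_resolution (R : comNzRingType) (N : lmodType R)
    (E : augmented N) : Prop :=
  injective_resolution E /\ forall i, essential (cocycles E i).

Definition zero_map (R : comNzRingType) (U V : lmodType R) :
  {linear U -> V} := \0.

Section DummyAugmented.
Variables (R : comNzRingType) (N : lmodType R).

Definition dummy_complex : complex R.
Proof.
by exists (fun=> N) (fun _ _ => zero_map N N).
Defined.

Definition dummy_augmented : augmented N :=
  @Augmented R N dummy_complex (zero_map N N).
End DummyAugmented.

(* A choice of the minimal injective resolution: every module has one, unique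
   up to isomorphism, so that the default value is never used. *)
Definition Einj (R : comNzRingType) (N : lmodType R) : augmented N :=
  choose_or (dummy_augmented N) (@minimal_injective_resolution R N).

Section Torsion.
Variables (R : comNzRingType) (J : {pred R}).

(* [x] is killed by a power of [J]: the ideal [J ^ n] is generated by the
   products of [n] elements of [J]. *)
Definition torsion_pred (M : lmodType R) : {pred M} := fun x =>
  `[< exists n, forall a : 'I_n -> R,
        (forall k, a k \in J) -> (\prod_k a k) *: x = 0 >].

Lemma torsion_pred_closed (M : lmodType R) :
  subsemimod_closed (@torsion_pred M).
Proof.
split; first split.
- by apply/asboolP; exists 0%N => a _; rewrite scaler0.
- move=> x y /asboolP[n xn] /asboolP[k yk]; apply/asboolP.
  exists (n + k)%N => a aJ; rewrite big_split_ord /= scalerDr.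
  rewrite mulrC -scalerA xn => [|l]; last exact: aJ.
  rewrite mulrC -scalerA yk => [|l]; last exact: aJ.
  by rewrite !scaler0 addr0.
- move=> b x /asboolP[n xn]; apply/asboolP; exists n => a aJ.
  by rewrite scalerA mulrC -scalerA xn ?scaler0.
Qed.

HB.instance Definition _ (M : lmodType R) :=
  GRing.isSubmodClosed.Build R M (@torsion_pred M) (torsion_pred_closed M).

Definition Gamma (M : lmodType R) : lmodType R := submod (@torsion_pred M).

Lemma torsion_map (U V : lmodType R) (f : {linear U -> V}) (x : U) :
  x \in @torsion_pred U -> f x \in @torsion_pred V.
Proof.
move=> /asboolP[n xn]; apply/asboolP; exists n => a aJ.
by rewrite -linearZZ xn // linear0.
Qed.

Definition Gamma_map (U V : lmodType R) (f : {linear U -> V}) :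
  {linear Gamma U -> Gamma V} := submod_map (@torsion_map U V f).

Definition Gamma_complex (C : complex R) : complex R.
Proof.
exists (fun i => Gamma (C i)) (fun i j => Gamma_map (diff C i j)).
- by move=> i j ij x; apply: val_inj; rewrite /= diff_shape.
- by move=> i j k x; apply: val_inj; rewrite /= diff_comp.
Defined.

Definition Gamma_cmap c (C D : complex R) (f : cmap c C D) :
  cmap c (Gamma_complex C) (Gamma_complex D).
Proof.
exists (fun i j => Gamma_map (f i j)).
- by move=> i j ij x; apply: val_inj; rewrite /= cmap_shape.
- by move=> i x; apply: val_inj; rewrite /= cmap_comm.
Defined.

Definition Gamma_incl_fun (M : lmodType R) (x : Gamma M) : M := val x.

Lemma Gamma_incl_is_linear (M : lmodType R) : linear (@Gamma_incl_fun M).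
Proof. by []. Qed.

HB.instance Definition _ (M : lmodType R) :=
  GRing.isLinear.Build R (Gamma M) M _ (@Gamma_incl_fun M)
    (@Gamma_incl_is_linear M).

Definition Gamma_incl (M : lmodType R) : {linear Gamma M -> M} :=
  @Gamma_incl_fun M.

Definition cmap_incl c (C D : complex R) (f : cmap c C (Gamma_complex D)) :
  cmap c C D.
Proof.
exists (fun i j => Gamma_incl (D j) \o f i j).
- by move=> i j ij x; rewrite /= cmap_shape.
- by move=> i x; rewrite /= cmap_comm.
Defined.
End Torsion.

Definition local_cohomology (R : comNzRingType) (J : {pred R}) (i : int)
    (M : lmodType R) : lmodType R :=
  cohomology (Gamma_complex J (Einj M)) i.

(* inf {i | H^i_I(M) <> 0}; the set of such i is bounded below, and it is not
   empty when M is nonzero and finitely generated over a Noetherian local ring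
   and I is a proper ideal. *)
Definition grade (R : comNzRingType) (I : {pred R}) (M : lmodType R) : int :=
  choose_or 0 (fun c => ~ is_zero (local_cohomology I c M) /\
    forall i, ~ is_zero (local_cohomology I i M) -> c <= i).

Section NaturalMap.
Variables (A : comNzRingType) (n J : {pred A}) (N : lmodType A) (c : int).

Let E := Einj N.
Let H := local_cohomology J c N.
Let L := Einj H.

Definition zero_cmap (C D : complex A) : cmap c C D.
Proof.
exists (fun i j => zero_map (C i) (D j)) => //.
by move=> i x; rewrite linear0.
Defined.

(* A lift of the embedding H^c_J(N)[-c] -> Gamma_J(E) to the injective
   resolution L of H^c_J(N): the augmentation followed by the lift sends the
   class of a cocycle z of Gamma_J(E) in degree c to z itself.  (This makes
   sense as there are no nonzero coboundaries in degree c <= grade(J, N).) *)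
Definition lifts_embedding (phi : cmap c L (Gamma_complex J E)) : Prop :=
  forall z : submod (cocycles (Gamma_complex J E) c),
    phi 0 c (aug L (quotmod_class (coboundaries (Gamma_complex J E) c) z)) =
    val z.

(* For c <= grade(J, N) such a lift exists and is unique up to homotopy: L is
   an exact resolution and, A being Noetherian, Gamma_J(E) consists of
   injective modules. *)
Definition embedding_lift : cmap c L (Gamma_complex J E) :=
  choose_or (zero_cmap L (Gamma_complex J E)) lifts_embedding.

(* RGamma_n of the embedding is represented by Gamma_n of the lift, a map from
   Gamma_n(L) to Gamma_n(Gamma_J(E)) = Gamma_n(E) (for J included in n). *)
Definition natural_map (i : int) :
  {linear local_cohomology n i (local_cohomology J c N) ->
          local_cohomology n (i + c) N} :=
  cohomology_map (Gamma_cmap n (cmap_incl embedding_lift)) i.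
End NaturalMap.

Section Localization.
Variables (R : comNzRingType) (p : prime_idealr R).

Definition denom : Type := {s : R | s \notin p}.
HB.instance Definition _ := SubChoice.on denom.

Definition dval (s : denom) : R := sval s.
Arguments dval : simpl never.

Lemma denom1_subproof : 1 \notin p.
Proof. by rewrite idealr1. Qed.
Definition denom1 : denom := Sub 1 denom1_subproof.

Lemma denomM_subproof (s t : denom) : dval s * dval t \notin p.
Proof. by rewrite prime_idealrM negb_or (valP s) (valP t). Qed.
Definition denomM (s t : denom) : denom :=
  Sub (dval s * dval t) (denomM_subproof s t).

Lemma dval1 : dval denom1 = 1. Proof. by []. Qed.
Lemma dvalM s t : dval (denomM s t) = dval s * dval t. Proof. by []. Qed.

Section Fractions.
Variable M : lmodType R.

Definition fraction : Type := (M * denom)%type.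
HB.instance Definition _ := Choice.on fraction.

(* (x, s) ~ (y, t) iff u (t x - s y) = 0 for some u outside p. *)
Definition frac_eq (X Y : fraction) : bool :=
  `[< exists u : denom,
      dval u *: (dval Y.2 *: X.1 - dval X.2 *: Y.1) = 0 >].

Lemma frac_eqP (X Y : fraction) : reflect
  (exists u : denom, (dval u * dval Y.2) *: X.1 = (dval u * dval X.2) *: Y.1)
  (frac_eq X Y).
Proof.
apply: (iffP (asboolP _)) => -[u hu]; exists u; move: hu.
  by rewrite scalerBr !scalerA => /eqP; rewrite subr_eq0 => /eqP.
by rewrite scalerBr !scalerA => ->; rewrite subrr.
Qed.

Lemma frac_eq_refl : reflexive frac_eq.
Proof. by move=> X; apply/frac_eqP; exists denom1. Qed.

Lemma frac_eq_sym : symmetric frac_eq.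
Proof. by move=> X Y; apply/frac_eqP/frac_eqP => -[u hu]; exists u. Qed.

Lemma frac_eq_trans : transitive frac_eq.
Proof.
move=> Y X Z /frac_eqP[u hu] /frac_eqP[v hv]; apply/frac_eqP.
exists (denomM (denomM u v) Y.2); rewrite !dvalM.
set a := dval u in hu *; set b := dval v in hv *.
set s := dval X.2 in hu *; set t := dval Y.2 in hu hv *.
set w := dval Z.2 in hv *.
have -> : a * b * t * w = (b * w) * (a * t) by ring.
rewrite -scalerA hu scalerA.
have -> : b * w * (a * s) = (a * s) * (b * w) by ring.
by rewrite -scalerA hv scalerA; congr (_ *: _); ring.
Qed.

Canonical frac_equiv := EquivRel frac_eq frac_eq_refl frac_eq_sym frac_eq_trans.
Canonical frac_encModRel := defaultEncModRel frac_eq.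

Definition localization : Type := {eq_quot frac_eq}.
HB.instance Definition _ := Choice.on localization.

Definition loc_frac (x : M) (s : denom) : localization :=
  \pi_({eq_quot frac_eq}) ((x, s) : fraction).

Definition loc_num (X : localization) : M := (repr (X : {eq_quot frac_eq})).1.
Definition loc_den (X : localization) : denom :=
  (repr (X : {eq_quot frac_eq})).2.

Lemma loc_fracK X : loc_frac (loc_num X) (loc_den X) = X.
Proof.
by rewrite /loc_frac /loc_num /loc_den -surjective_pairing; apply: reprK.
Qed.

Lemma frac_ind (P : localization -> Prop) :
  (forall x s, P (loc_frac x s)) -> forall X, P X.
Proof. by move=> Pfrac X; rewrite -[X]loc_fracK. Qed.

Lemma eq_frac x s y t : loc_frac x s = loc_frac y t <->
  exists u : denom, (dval u * dval t) *: x = (dval u * dval s) *: y.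
Proof.
split=> [/eqmodP/frac_eqP //|h].
by apply/eqmodP/frac_eqP.
Qed.

Lemma frac_num x s : exists u : denom,
  (dval u * dval (loc_den (loc_frac x s))) *: x =
  (dval u * dval s) *: loc_num (loc_frac x s).
Proof. by apply/eq_frac; rewrite loc_fracK. Qed.

Definition loc_add (X Y : localization) : localization :=
  loc_frac (dval (loc_den Y) *: loc_num X + dval (loc_den X) *: loc_num Y)
    (denomM (loc_den X) (loc_den Y)).

Lemma loc_addE x s y t :
  loc_add (loc_frac x s) (loc_frac y t) =
  loc_frac (dval t *: x + dval s *: y) (denomM s t).
Proof.
have [u hu] := frac_num x s; have [v hv] := frac_num y t.
rewrite /loc_add; set X := loc_frac x s in hu *; set Y := loc_frac y t in hv *.
apply/eq_frac; exists (denomM u v); rewrite !dvalM.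
set a := dval u in hu *; set b := dval v in hv *.
set s' := dval (loc_den X) in hu *; set t' := dval (loc_den Y) in hv *.
rewrite !scalerDr !scalerA; congr (_ + _).
  have -> : a * b * (dval s * dval t) * t' =
    (b * dval t * t') * (a * dval s) by ring.
  rewrite -scalerA -hu scalerA; congr (_ *: _); ring.
have -> : a * b * (dval s * dval t) * s' =
  (a * dval s * s') * (b * dval t) by ring.
rewrite -scalerA -hv scalerA; congr (_ *: _); ring.
Qed.

Definition loc_zero : localization := loc_frac 0 denom1.
Definition loc_opp (X : localization) : localization :=
  loc_frac (- loc_num X) (loc_den X).

Lemma loc_oppE x s : loc_opp (loc_frac x s) = loc_frac (- x) s.
Proof.
have [u hu] := frac_num x s.
by apply/eq_frac; exists u; rewrite !scalerN hu.
Qed.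

Lemma loc_addA : associative loc_add.
Proof.
elim/frac_ind=> x s; elim/frac_ind=> y t; elim/frac_ind=> z w.
rewrite !loc_addE; apply/eq_frac; exists denom1; rewrite ?dvalM !dval1 !mul1r.
rewrite !scalerDr !scalerA !addrA; congr (_ *: _ + _ *: _ + _ *: _); ring.
Qed.

Lemma loc_addC : commutative loc_add.
Proof.
elim/frac_ind=> x s; elim/frac_ind=> y t.
rewrite !loc_addE; apply/eq_frac; exists denom1; rewrite ?dvalM !dval1 !mul1r.
by rewrite addrC mulrC.
Qed.

Lemma loc_add0 : left_id loc_zero loc_add.
Proof.
elim/frac_ind=> x s; rewrite loc_addE; apply/eq_frac; exists denom1.
by rewrite ?dvalM !dval1 !mul1r scaler0 add0r scale1r.
Qed.

Lemma loc_addN : left_inverse loc_zero loc_opp loc_add.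
Proof.
elim/frac_ind=> x s; rewrite loc_oppE loc_addE; apply/eq_frac; exists denom1.
by rewrite scalerN addNr !scaler0.
Qed.

HB.instance Definition _ := GRing.isZmodule.Build localization
  loc_addA loc_addC loc_add0 loc_addN.
End Fractions.

Definition locring : Type := localization R^o.
HB.instance Definition _ := GRing.Zmodule.on locring.

Definition loc_scale (M : lmodType R) (A : locring) (X : localization M) :
  localization M :=
  loc_frac ((loc_num A : R) *: loc_num X) (denomM (loc_den A) (loc_den X)).

Lemma loc_scaleE (M : lmodType R) (a : R) s (x : M) t :
  loc_scale (loc_frac (a : R^o) s) (loc_frac x t) =
  loc_frac (a *: x) (denomM s t).
Proof.
have [u hu] := frac_num (a : R^o) s; have [v hv] := frac_num x t.
rewrite /loc_scale; set X := loc_frac _ s in hu *.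
set Y := loc_frac x t in hv *.
apply/eq_frac; exists (denomM u v); rewrite !dvalM.
rewrite !scalerA.
have -> : dval u * dval v * (dval s * dval t) * loc_num X =
  (dval u * dval s * loc_num X) * (dval v * dval t) by ring.
rewrite -scalerA -hv scalerA -[dval u * dval s * loc_num X]hu.
by congr (_ *: _); rewrite /GRing.scale /=; ring.
Qed.

Lemma loc_scaleA (M : lmodType R) A B (X : localization M) :
  loc_scale A (loc_scale B X) = loc_scale (loc_scale A B : locring) X.
Proof.
elim/frac_ind: A => a s; elim/frac_ind: B => b t; elim/frac_ind: X => x w.
rewrite (loc_scaleE b) (loc_scaleE a s (b : R^o)) !loc_scaleE.
apply/eq_frac; exists denom1.
by rewrite !dvalM !scalerA; congr (_ *: _); rewrite /GRing.scale /=; ring.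
Qed.

Lemma loc_scaleC (A B : locring) : loc_scale A B = loc_scale B A :> locring.
Proof.
elim/frac_ind: A => a s; elim/frac_ind: B => b t.
rewrite !loc_scaleE; apply/eq_frac; exists denom1.
by rewrite !dvalM /GRing.scale /=; ring.
Qed.

Lemma loc_scaleDr (M : lmodType R) (A : locring) :
  {morph @loc_scale M A : X Y / X + Y}.
Proof.
elim/frac_ind: A => a s; elim/frac_ind=> x t; elim/frac_ind=> y w.
rewrite [loc_frac x t + _]loc_addE !loc_scaleE [RHS]loc_addE.
apply/eq_frac; exists denom1; rewrite !dvalM ?dval1 !scalerDr !scalerA.
by congr (_ *: _ + _ *: _); ring.
Qed.

Lemma loc_scaleDl (M : lmodType R) (X : localization M) :
  {morph (@loc_scale M)^~ X : A B / A + B}.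
Proof.
elim/frac_ind=> a s; elim/frac_ind=> b t; elim/frac_ind: X => x w.
rewrite [loc_frac _ s + _]loc_addE !loc_scaleE [RHS]loc_addE.
apply/eq_frac; exists denom1; rewrite !dvalM ?dval1 scalerDl !scalerDr !scalerA.
by congr (_ *: _ + _ *: _); rewrite /GRing.scale /=; ring.
Qed.

Definition loc_one : locring := loc_frac (1 : R^o) denom1.

Lemma loc_scale1 (M : lmodType R) : left_id loc_one (@loc_scale M).
Proof.
elim/frac_ind=> x s; rewrite loc_scaleE; apply/eq_frac; exists denom1.
by rewrite ?dvalM !dval1 !mul1r scale1r.
Qed.

Lemma loc_one_neq0 : loc_one != 0.
Proof.
apply/eqP => /eq_frac[u]; rewrite scaler0 mulr1 /GRing.scale /= mulr1 => u0.
by have := valP u; rewrite -[val u]/(dval u) u0 idealr0.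
Qed.

Lemma loc_mulDl : left_distributive (@loc_scale R^o) +%R.
Proof. by move=> A B X; apply: loc_scaleDl. Qed.

HB.instance Definition _ := GRing.Zmodule_isComNzRing.Build locring
  (@loc_scaleA R^o) loc_scaleC (@loc_scale1 R^o) loc_mulDl
  loc_one_neq0.

HB.instance Definition _ (M : lmodType R) :=
  GRing.Zmodule_isLmodule.Build locring (localization M)
    (@loc_scaleA M) (@loc_scale1 M) (@loc_scaleDr M)
    (@loc_scaleDl M).

(* The extension of an ideal [I] of [R]: the ideal of [R_p] generated by the
   fractions a / 1 with [a] in [I]. *)
Definition ext_ideal (I : {pred R}) : {pred locring} := fun x =>
  `[< exists n (b : 'I_n -> locring) (a : 'I_n -> R),
        (forall k, a k \in I) /\
        x = \sum_k b k * loc_frac (a k : R^o) denom1 >].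
End Localization.
Arguments ext_ideal {R} p I.

Definition in_supp (R : comNzRingType) (M : lmodType R) (p : prime_idealr R) :
  Prop := ~ is_zero (localization p M).

(* Main.v *)
Require Import Defs.
From HB Require Import structures.
From mathcomp Require Import all_boot all_order all_algebra.
From mathcomp Require Import ring_quotient boolp classical_sets ring zify.

(** Write [N = M_p], [J = I R_p], [n = p R_p] and [E] for the minimal injective
    resolution of [N].  Under (i), localization shows that the bounded below
    complex of injectives [Gamma_J(E)] has no cohomology but [H^c_J(N)], so the
    lift [phi] of the embedding is a quasi-isomorphism; its cone is exact, hence
    contractible, and stays exact after applying [Gamma_n].  Conversely, take
    the lowest [i > c] with [H^i_I(M) <> 0] and let [p] be an associated prime
    of it.  The cone of [phi] is exact below degree [i - c], where it has a
    nonzero class killed by [n]; contracting the cone below that degree makes a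
    representative of this class [n]-torsion, whereas (ii) says that [Gamma_n]
    of the cone is exact. *)

Set Implicit Arguments.
Unset Strict Implicit.
Unset Printing Implicit Defensive.

Import Order.TTheory GRing.Theory Num.Theory.
Local Open Scope ring_scope.

(** * Linear maps and submodules *)

(** The functor [Gamma_n] does not preserve exactness in general. It does on bounded below complexes
    of injectives, because the maps h with d h d = d given by [contraction] are linear and hence
    preserve torsion. So every complex that is coned off must consist of injectives. This is where
    finite generation of ideals is decisive: it makes [Gamma_J(E)] and localizations of injectives
    injective. As [Einj] is a choice with a default value, minimal injective resolutions have to be
    constructed, starting from Q/Z. Minimality itself serves only to make [Gamma_J(E)] vanish below
    degree c, so that classes in degree c are the same as cocycles. The resolution chosen for M_p
    has no literal relation to the localized resolution of M; the two are linked by a comparison map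
    that stays a quasi-isomorphism under [Gamma_J]. In the converse, a class killed by n need not
    have an n-torsion representative. Taking the lowest bad degree makes the cone exact below it,
    and this is what allows the representative to be corrected. *)

Section LinearMaps.
Variable R : comNzRingType.

Section MkLin.
Variables (U V : lmodType R) (f : U -> V) (flin : linear f).
(** The proof of linearity is an argument so that a structure can be attached to the resulting term.
    The same device serves in [sub_pred] and [ann_prime_pred]. *)
Definition lin_fun of linear f := f.
HB.instance Definition _ := GRing.isLinear.Build R U V _ (lin_fun flin) flin.
Definition mklin : {linear U -> V} := lin_fun flin.
Lemma mklinE x : mklin x = f x. Proof. by []. Qed.
End MkLin.

Lemma inj_of_ker0 (U V : lmodType R) (f : {linear U -> V}) :
  (forall x, f x = 0 -> x = 0) -> injective f.
Proof.
move=> f0 x y /eqP; rewrite -subr_eq0 -linearB => /eqP/f0/eqP.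
by rewrite subr_eq0 => /eqP.
Qed.

Definition is_submod (M : lmodType R) (P : M -> Prop) : Prop :=
  [/\ P 0, forall x y, P x -> P y -> P (x + y) & forall a x, P x -> P (a *: x)].

Section MkSub.
Variables (M : lmodType R) (P : M -> Prop) (PS : is_submod P).
Definition sub_pred of is_submod P : {pred M} := fun x => `[< P x >].
Lemma sub_pred_closed : subsemimod_closed (sub_pred PS).
Proof.
case: (PS) => P0 PD PZ; split; first split.
- exact/asboolP.
- by move=> x y /asboolP Px /asboolP Py; apply/asboolP; apply: PD.
- by move=> a x /asboolP Px; apply/asboolP; apply: PZ.
Qed.
HB.instance Definition _ := GRing.isSubmodClosed.Build R M (sub_pred PS)
  sub_pred_closed.
Definition mksub : submodClosed M := sub_pred PS.
Lemma mksubP x : reflect (P x) (x \in mksub). Proof. exact: asboolP. Qed.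
End MkSub.

Lemma is_submod_mem (M : lmodType R) (S : submodClosed M) :
  is_submod (fun x => x \in S).
Proof.
by split=> [|x y|a x]; [exact: rpred0 | exact: rpredD | exact: rpredZ].
Qed.

Lemma is_submodB (M : lmodType R) (P : M -> Prop) x y :
  is_submod P -> P x -> P y -> P (x - y).
Proof. by case=> _ PD PZ Px Py; apply: PD => //; rewrite -scaleN1r; apply: PZ. Qed.

Section Subquotients.
Variables (M V : lmodType R) (S : submodClosed M).

Lemma sub_val_linear : linear (fun x : submod S => val x).
Proof. by []. Qed.
Lemma sub_valZ a (x : submod S) : val (a *: x) = a *: val x.
Proof. by []. Qed.
Definition sub_val : {linear submod S -> M} := mklin sub_val_linear.

Lemma quotmod_class0 x : quotmod_class S x = 0 <-> x \in S.
Proof. by rewrite -(linear0 (quotmod_class S)) quotmod_classP subr0. Qed.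

Lemma quotmodP (X : quotmod S) : exists x, X = quotmod_class S x.
Proof. by exists (quotmod_repr X); rewrite quotmod_reprK. Qed.

Section Corestrict.
Variables (f : {linear V -> M}) (fS : forall x, f x \in S).
Definition corestr_fun (x : V) : submod S := exist _ (f x) (fS x).
Lemma corestr_linear : linear corestr_fun.
Proof. by move=> a x y; apply: val_inj; rewrite /= linearP. Qed.
Definition corestr : {linear V -> submod S} := mklin corestr_linear.
Lemma val_corestr x : val (corestr x) = f x. Proof. by []. Qed.
End Corestrict.

Section Lift.
Variables (f : {linear M -> V}) (fS : forall x, x \in S -> f x = 0).
Definition quot_lift_fun (X : quotmod S) : V := f (quotmod_repr X).
Lemma quot_lift_class x : quot_lift_fun (quotmod_class S x) = f x.
Proof.
apply/eqP; rewrite -subr_eq0 -linearB; apply/eqP/fS/quotmod_classP.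
exact: quotmod_reprK.
Qed.
Lemma quot_lift_linear : linear quot_lift_fun.
Proof.
move=> a X Y; rewrite -[X]quotmod_reprK -[Y]quotmod_reprK -linearP.
by rewrite !quot_lift_class linearP.
Qed.
Definition quot_lift : {linear quotmod S -> V} := mklin quot_lift_linear.
Lemma quot_liftE x : quot_lift (quotmod_class S x) = f x.
Proof. exact: quot_lift_class. Qed.
End Lift.
End Subquotients.

(** Both maps descend to the quotient of A by the kernel of f, and this quotient embeds in B. *)
Lemma inj_factor (E : lmodType R) : injective_module E ->
  forall (A B : lmodType R) (f : {linear A -> B}) (g : {linear A -> E}),
    (forall x, f x = 0 -> g x = 0) ->
  exists h : {linear B -> E}, forall x, h (f x) = g x.
Proof.
move=> injE A B f g fg.
have fK x : x \in (ker_pred f : submodClosed A) -> f x = 0 by move/eqP.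
have gK x : x \in (ker_pred f : submodClosed A) -> g x = 0 by move/eqP/fg.
have [|h hE] := injE _ _ (quot_lift fK) (quot_lift gK).
  apply: inj_of_ker0 => X; have [x ->] := quotmodP X.
  by rewrite quot_liftE => fx0; apply/quotmod_class0; rewrite in_ker fx0.
by exists h => x; rewrite -(quot_liftE fK) hE quot_liftE.
Qed.

Lemma inj_extend (E : lmodType R) : injective_module E ->
  forall (B : lmodType R) (S : submodClosed B) (g : {linear submod S -> E}),
  exists h : {linear B -> E}, forall x, h (val x) = g x.
Proof.
move=> injE B S g; have [x|h hE] := inj_factor injE (f := sub_val S) (g := g).
  by move=> /= x0; rewrite (_ : x = 0) ?linear0 //; apply: val_inj.
by exists h.
Qed.

Lemma inj_retract (E V : lmodType R) (s : {linear V -> E}) (r : {linear E -> V}) :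
  injective_module E -> cancel s r -> injective_module V.
Proof.
move=> injE sK A B f g finj.
have [h hE] := injE _ _ f (s \o g) finj.
by exists (r \o h) => x; rewrite /= hE /= sK.
Qed.

Lemma inj_prod (U V : lmodType R) :
  injective_module U -> injective_module V -> injective_module (U * V)%type.
Proof.
move=> injU injV A B f g finj.
have [h hE] := injU _ _ f (fst \o g) finj.
have [k kE] := injV _ _ f (snd \o g) finj.
have hk : linear (fun x => (h x, k x)).
  by move=> a x y; rewrite !linearP; congr (_, _).
by exists (mklin hk) => x; rewrite mklinE hE kE /=; case: (g x).
Qed.
End LinearMaps.

(** * Injective modules and injective hulls *)

(** Zorn's lemma is applied to [P] enlarged by the empty set, which takes care of the union of the
    empty chain. If the maximal element found is empty, every set satisfying [P] is empty, and S0 is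
    maximal. *)
Lemma zorn_nonempty_chain (T : Type) (P : set T -> Prop) (S0 : set T) :
  P S0 ->
  (forall F : set (set T), (exists X, F X) -> (forall X, F X -> P X) ->
    total_on F subset -> P (\bigcup_(X in F) X)%classic) ->
  exists2 A, P A & forall B, P B -> (A `<=` B)%classic -> (B `<=` A)%classic.
Proof.
move=> PS0 Pchain.
have [F FP Ftot|A [PA maxA]] := @Zorn_bigcup T (fun X => X = set0 \/ P X).
  have [[X [FX PX]]|noP] := pselect (exists X, F X /\ P X); last first.
    left; rewrite -subset0 => x [X FX Xx].
    have [X0|PX] := FP _ FX; first by rewrite X0 in Xx.
    by case: noP; exists X.
  right; rewrite (_ : bigcup _ _ = \bigcup_(Y in [set Y | F Y /\ P Y]) Y)%classic.
    apply: Pchain; [by exists X | by move=> Y []|].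
    by move=> Y Z [FY _] [FZ _]; apply: Ftot.
  apply/seteqP; split=> x [Y FY Yx]; last by exists Y => //; case: FY.
  by have [Y0|PY] := FP _ FY; [rewrite Y0 in Yx | exists Y].
have Qmax B : P B -> (A `<=` B)%classic -> (B `<=` A)%classic.
  move=> PB AB; apply: contrapT => nBA.
  by apply: (maxA B); [split | right].
have [A0|PA'] := PA; last by exists A.
exists S0 => // B PB _ x Bx.
by have := Qmax B PB; rewrite A0 => /(_ (@sub0set _ _)) /(_ x Bx).
Qed.

Lemma is_submod_bigcup (R : comNzRingType) (M : lmodType R)
    (F : set (set M)) :
  (exists X, F X) -> (forall X, F X -> is_submod X) -> total_on F subset ->
  is_submod (\bigcup_(X in F) X)%classic.
Proof.
move=> [X0 FX0] FS Ftot; split.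
- by exists X0 => //; case: (FS _ FX0).
- move=> x y [X FX Xx] [Y FY Yy]; have [XY|YX] := Ftot _ _ FX FY.
    by exists Y => //; case: (FS _ FY) => _ + _; apply=> //; apply: XY.
  by exists X => //; case: (FS _ FX) => _ + _; apply=> //; apply: YX.
- by move=> a x [X FX Xx]; exists X => //; case: (FS _ FX) => _ _; apply.
Qed.

Section Baer.
Variable R : comNzRingType.

(** Baer's criterion with the map from an ideal to E given by its graph g, so that partially defined
    maps can be used without forming the type of their domain. *)
Definition baer (E : lmodType R) : Prop :=
  forall (I : R -> Prop) (g : R -> E -> Prop),
    (forall a, I a -> exists e, g a e) ->
    (forall a e e', g a e -> g a e' -> e = e') -> g 0 0 ->
    (forall a b e f, g a e -> g b f -> g (a + b) (e + f)) ->
    (forall r a e, g a e -> g (r * a) (r *: e)) ->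
  exists y, forall a e, I a -> g a e -> e = a *: y.

(* The maximal elements are graphs of partial extensions of [g] along [f]. *)
Lemma baer_injective (E : lmodType R) : baer E -> injective_module E.
Proof.
move=> baerE A B f g finj.
pose gr (G : set (B * E)%type) := [/\ is_submod G,
  forall e, G (0, e) -> e = 0 & forall a, G (f a, g a)].
have [|F Fn FG Ftot|G [Gsub G0 Gf] Gmax] := @zorn_nonempty_chain _ gr
    (fun p => exists a, p = (f a, g a)).
- split; last by move=> a; exists a.
    split.
    + by exists 0; rewrite !linear0.
    + by move=> _ _ [a ->] [b ->]; exists (a + b); rewrite !linearD.
    + by move=> r _ [a ->]; exists (r *: a); rewrite !linearZZ.
  by move=> e [a [/esym]]; rewrite -(linear0 f) => /finj -> ->; rewrite linear0.
- split.
  + by apply: is_submod_bigcup => // X /FG[].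
  + by move=> e [X /FG[_ X0 _] /X0].
  + by move=> a; case: Fn => X FX; exists X => //; case: (FG _ FX).
have [GS0 GSD GSZ] := Gsub.
have Gfun b e e' : G (b, e) -> G (b, e') -> e = e'.
  move=> Ge Ge'; apply/eqP; rewrite -subr_eq0; apply/eqP/G0.
  by rewrite (_ : (_, _) = (b, e) - (b, e')) ?subrr//;
    [apply: is_submodB | congr (_, _); rewrite /= subrr].
have Gtot b : exists e, G (b, e).
  have [||||| y yP] := baerE (fun r => exists e, G (r *: b, e))
      (fun r e => G (r *: b, e)).
  - by [].
  - by move=> a e e'; apply: Gfun.
  - by rewrite scale0r.
  - by move=> r s e e' Ge Ge'; rewrite scalerDl; have := GSD _ _ Ge Ge'.
  - by move=> r s e Ge; rewrite -scalerA; have := GSZ r _ Ge.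
  (* Adjoining (b, y) to the graph keeps it single-valued: by the choice of y, the graph already
     sends r b to r y whenever r b lies in its domain. *)
  pose G' (p : B * E) := exists (q : B * E) r, G q /\ p = q + r *: ((b, y) : B * E).
  exists y; apply: (Gmax G').
  - split.
    + split.
      * by exists 0, 0; split=> //; rewrite scale0r addr0.
      * move=> _ _ [q [r [Gq ->]]] [q' [r' [Gq' ->]]].
        by exists (q + q'), (r + r'); split; [exact: GSD | rewrite scalerDl addrACA].
      * move=> a _ [q [r [Gq ->]]]; exists (a *: q), (a * r).
        by split; [exact: GSZ | rewrite scalerDr scalerA].
    + move=> e [[c e'] [r [Gq [/esym/eqP]]]]; rewrite addr_eq0 => /eqP cE ->.
      have Ge' : G (r *: b, - e').
        have := GSZ (-1) _ Gq; rewrite cE !scaleN1r /=.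
        rewrite [X in G X](_ : _ = (r *: b, - e')) //.
        by congr (_, _); rewrite /= opprK.
      by rewrite -(yP r _ _ Ge') ?subrr//; exists (- e').
    + by move=> a; exists (f a, g a), 0; split; rewrite ?scale0r ?addr0.
  - by move=> q Gq; exists q, 0; rewrite scale0r addr0.
  - by exists 0, 1; split=> //; rewrite scale1r add0r.
have [h hP] := choice Gtot.
have hlin : linear h.
  move=> a x y; apply: (Gfun (a *: x + y)) => //.
  by have := GSD _ _ (GSZ a _ (hP x)) (hP y).
by exists (mklin hlin) => x; rewrite mklinE; apply: Gfun (hP _) (Gf x).
Qed.
End Baer.

Section Hull.
Variables (R : comNzRingType) (E : lmodType R).
Hypothesis injE : injective_module E.

Definition ess_over (S H : set E) : Prop :=
  forall x, H x -> x <> 0 -> exists2 r, S (r *: x) & r *: x <> 0.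

(* [H] is a maximal essential extension of [S] and [K] a maximal submodule
   meeting [H] trivially; [h : E / K -> E] extends the inclusion of [H], is
   injective since [H] is essential in [E / K], and its image is then an
   essential extension of [H], hence is [H]. *)
Lemma hull_retraction (S : set E) : is_submod S ->
  exists (H : set E) (rho : {linear E -> E}),
    [/\ is_submod H, (S `<=` H)%classic, ess_over S H,
        forall x, H (rho x) & forall x, H x -> rho x = x].
Proof.
move=> Ssub.
have [|F [X0 FX0] FP Ftot|H [Hsub SH HS] Hmax] := @zorn_nonempty_chain _
    (fun H : set E => [/\ is_submod H, (S `<=` H)%classic & ess_over S H]) S.
- by split=> // x Sx x0; exists 1; rewrite scale1r.
- split.
  + by apply: is_submod_bigcup => //; [exists X0 | move=> X /FP[]].
  + by move=> x Sx; exists X0 => //; have [_ + _] := FP _ FX0; apply.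
  + by move=> x [X FX Xx]; have [_ _] := FP _ FX; apply.
have [|F [X0 FX0] FP Ftot|K [Ksub KH] Kmax] := @zorn_nonempty_chain _
    (fun K : set E => is_submod K /\ forall x, K x -> H x -> x = 0) (fun x => x = 0).
- split; last by move=> x ->.
  by split=> [//|x y -> ->|a x ->]; rewrite ?addr0 ?scaler0.
- split.
  + by apply: is_submod_bigcup => //; [exists X0 | move=> X /FP[]].
  + by move=> x [X FX Xx]; have [_] := FP _ FX; apply.
have [H0 HD HZ] := Hsub; have [K0 KD KZ] := Ksub.
pose HS' := mksub Hsub; pose KS := mksub Ksub.
have [x|h hE] := inj_factor injE (f := quotmod_class KS \o sub_val HS')
    (g := sub_val HS').
  move=> /= /quotmod_class0/mksubP Kx; apply: KH => //.
  exact/mksubP/(valP x).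
have {}hE x : H x -> h (quotmod_class KS x) = x.
  by move=> /(mksubP Hsub) Hx; have := hE (exist _ x Hx).
(* By maximality of K, the submodule K + R e meets H in a nonzero element; modulo K this is a
   multiple of e. *)
have Kess e : ~ K e ->
    exists r x, [/\ H x, x <> 0 & quotmod_class KS (r *: e) = quotmod_class KS x].
  move=> Ke; apply: contrapT => nex; apply: Ke.
  apply: (Kmax (fun x => exists k r, K k /\ x = k + r *: e)).
  - split; first split.
    + by exists 0, 0; rewrite scale0r addr0.
    + move=> _ _ [k [r [Kk ->]]] [k' [r' [Kk' ->]]].
      by exists (k + k'), (r + r'); rewrite scalerDl addrACA; split=> //; apply: KD.
    + move=> a _ [k [r [Kk ->]]]; exists (a *: k), (a * r).
      by rewrite scalerDr scalerA; split=> //; apply: KZ.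
    + move=> _ [k [r [Kk ->]]] Hx; apply: contrapT => x0.
      apply: nex; exists r, (k + r *: e); split=> //.
      by apply/esym/quotmod_classP; rewrite addrK; apply/mksubP.
  - by move=> k Kk; exists k, 0; rewrite scale0r addr0.
  - by exists 0, 1; rewrite add0r scale1r.
have imH e : H (h (quotmod_class KS e)).
  apply: (Hmax (fun x => exists e, x = h (quotmod_class KS e))).
  - split.
    + split; first by exists 0; rewrite !linear0.
        by move=> _ _ [x ->] [y ->]; exists (x + y); rewrite !linearD.
      by move=> a _ [x ->]; exists (a *: x); rewrite !linearZZ.
    + by move=> x Sx; exists x; rewrite hE //; apply: SH.
    + move=> _ [x ->] hx0.
      have [|r [y [Hy y0 ryE]]] := Kess x.
        by move/(mksubP Ksub)/quotmod_class0 => x0; rewrite x0 linear0 in hx0.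
      have [s Ssy sy0] := HS _ Hy y0.
      have ryh : h (quotmod_class KS (r *: x)) = r *: h (quotmod_class KS x).
        by rewrite !linearZZ.
      by exists (s * r); rewrite -scalerA -ryh ryE hE.
  - by move=> x Hx; exists x; rewrite hE.
  - by exists e.
exists H, (h \o quotmod_class KS); by split.
Qed.

(** The hull is found inside E, where the retraction of [hull_retraction] exhibits it as a direct
    summand; injectivity follows. *)
Lemma inj_hull (S : submodClosed E) :
  exists H : submodClosed E, [/\ {subset S <= H},
    injective_module (submod H) &
    forall x, x \in H -> x <> 0 -> exists2 r, r *: x \in S & r *: x <> 0].
Proof.
have [H [rho [Hsub SH HS rhoH rhoid]]] := hull_retraction (is_submod_mem S).
exists (mksub Hsub); split.
- by move=> x /SH Hx; apply/mksubP.
- have rhoH' x : rho x \in mksub Hsub by apply/mksubP.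
  apply: (inj_retract (s := sub_val (mksub Hsub)) (r := corestr rhoH')) => //.
  by move=> x; apply: val_inj; rewrite val_corestr rhoid //; apply/mksubP/(valP x).
- by move=> x /mksubP Hx x0; apply: HS.
Qed.
End Hull.

(** * The injective cogenerator Q/Z of abelian groups *)

Section RationalsModIntegers.

Lemma ratz_linear : linear (fun n : int^o => (n%:~R : zmodule rat)).
Proof. by move=> a m n; rewrite scalezrE intrD intrM mulrzl. Qed.

Definition QZ : lmodType int := quotmod (im_pred (mklin ratz_linear)).
Definition toQZ : {linear zmodule rat -> QZ} :=
  quotmod_class (im_pred (mklin ratz_linear)).

Lemma toQZ_eq0 (x : rat) : toQZ x = 0 <-> exists n : int, x = n%:~R.
Proof.
split=> [/quotmod_class0/asboolP[n <-]|[n ->]]; first by exists n.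
by apply/quotmod_class0/asboolP; exists n.
Qed.

Lemma QZ_divisible (n : int) (y : QZ) : n != 0 -> exists x : QZ, n *: x = y.
Proof.
move=> n0; have [q ->] := quotmodP y.
exists (toQZ ((q : rat) / n%:~R)); rewrite -linearZZ /toQZ; congr (quotmod_class _ _).
by rewrite scalezrE -mulrzl mulrC divfK // intr_eq0.
Qed.

(** Ideals of Z are principal, by Euclidean division. The zero ideal is kept apart because both uses
    treat it differently: it cannot be divided by, and it is the annihilator of elements of infinite
    order. *)
Lemma least_positive (P : int -> Prop) :
  (forall a b, P a -> P b -> P (a + b)) -> (forall a b, P b -> P (a * b)) ->
  (forall a, P a -> a = 0) \/
  exists n : nat, [/\ (0 < n)%N, P n & forall a, P a -> (n %| a)%Z].
Proof.
move=> PD PM.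
have [[a [Pa a0]]|noP] := pselect (exists a, P a /\ a != 0); last first.
  by left=> a Pa; apply/eqP; apply: contrapT => /negP a0; apply: noP; exists a.
right; have ex : exists n : nat, `[< (0 < n)%N /\ P n >].
  exists `|a|%N; apply/asboolP; split; first by rewrite absz_gt0.
  have [->//|->] : (`|a|%N : int) = a \/ (`|a|%N : int) = -1 * a by lia.
  exact: PM.
case: (ex_minnP ex) => n /asboolP[n0 Pn] nmin; exists n; split=> // b Pb.
have n0' : (n : int) != 0 by rewrite -lt0n.
have: P (b %% n)%Z.
  by rewrite /modz -mulNr; apply: PD => //; apply: PM.
have := modz_ge0 b n0'; have := ltz_mod b n0'.
case E : (b %% n)%Z => [r|//] rn _ Pr; apply/dvdz_mod0P; rewrite E.
case: r rn Pr {E} => // r rn Pr.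
have := nmin r.+1; rewrite leqNgt => /(_ _)/negP; case; last by lia.
exact/asboolP.
Qed.

Lemma QZ_injective : injective_module QZ.
Proof.
apply: baer_injective => I g gI gfun g00 gD gM.
have g0 e : g 0 e -> e = 0.
  by move=> ge; apply: (gfun 0) => //; have := gM 0 _ _ ge; rewrite mul0r scale0r.
have [|a b [e ge]|I0|[n [n0 [e ge] Idiv]]] :=
    @least_positive (fun a => exists e, g a e).
- by move=> a b [e ge] [f gf]; exists (e + f); apply: gD.
- by exists (a *: e); apply: gM.
- exists 0 => a e _ ge; rewrite scaler0; apply: g0.
  by rewrite -{1}(I0 a) //; exists e.
- have [|y yE] := @QZ_divisible n e; first by rewrite -lt0n.
  exists y => a f _ gf.
  have /dvdzP[q aE] : (n %| a)%Z by apply: Idiv; exists f.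
  rewrite aE -scalerA yE; apply: (gfun a) => //.
  by rewrite aE; apply: gM.
Qed.

(** Send v to the class of 1/n if v has finite order n, and to the class of 1/2 if its order is
    infinite. This is well defined and nonzero on the subgroup generated by v, and it extends to V
    by injectivity of Q/Z. *)
Lemma QZ_separates (V : lmodType int) (v : V) : v != 0 ->
  exists f : {linear V -> QZ}, f v <> 0.
Proof.
move=> v0.
have [q q0 qP] : exists2 q : QZ, q <> 0 &
    forall n : int, n *: v = 0 -> n *: q = 0.
  have [a b|a b|I0|[n [n0 nv Idiv]]] := @least_positive (fun a => a *: v = 0).
  - by move=> av bv; rewrite scalerDl av bv addr0.
  - by move=> bv; rewrite -scalerA bv scaler0.
  - exists (toQZ (2%:R^-1 : rat)).
      move/toQZ_eq0 => [k kE].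
      have : (1 : int)%:~R = (k * 2)%:~R :> rat by rewrite intrM -kE.
      by move/intr_inj; lia.
    by move=> n /I0 ->; rewrite scale0r.
  - have n0' : (n%:~R : rat) != 0 by rewrite intr_eq0 -lt0n.
    exists (toQZ (n%:~R^-1 : rat)).
      move/toQZ_eq0 => [k kE].
      have : (1 : int)%:~R = (k * n)%:~R :> rat by rewrite intrM -kE mulVf.
      move/intr_inj => e1.
      have : `|(k * n : int)|%N = 1%N by rewrite -e1.
      rewrite abszM => /eqP; rewrite muln_eq1 => /andP[_ /eqP n1].
      rewrite absz_nat in n1; rewrite n1 scale1r in nv.
      by rewrite nv eqxx in v0.
    move=> m /Idiv/dvdzP[k ->]; rewrite -linearZZ; apply/toQZ_eq0; exists k.
    by rewrite scalezrE -mulrzl intrM mulfK.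
have linm (W : lmodType int) (w : W) : linear (fun n : int^o => n *: w).
  by move=> a m n; rewrite scalerDl scalerA.
have [|h hE] := inj_factor QZ_injective (f := mklin (linm _ v)) (g := mklin (linm _ q)).
  by move=> n; rewrite !mklinE; apply: qP.
exists h; have := hE 1; rewrite !mklinE !scale1r => ->; exact: q0.
Qed.
End RationalsModIntegers.

(** * Coinduced modules and enough injectives *)

Section Coinduced.
Variables (R : comNzRingType) (X : Type).

(* The module of maps [X -> Hom_Z(R, Q/Z)], with R acting by translation of
   the argument. *)
Record coind : Type := Coind {
  coind_fun :> X -> R -> QZ;
  coind_add : forall x, {morph coind_fun x : r s / r + s}
}.

HB.instance Definition _ := gen_eqMixin coind.
HB.instance Definition _ := gen_choiceMixin coind.

Lemma coind_eq (f g : coind) : (forall x r, f x r = g x r) -> f = g.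
Proof.
case: f g => f fD [g gD] /= fg.
have E : f = g by apply/funext => x; apply/funext => r.
by rewrite E in fD *; congr Coind; apply: Prop_irrelevance.
Qed.

Definition coind_addf (f g : coind) : coind.
Proof.
exists (fun x r => f x r + g x r) => x r s.
by rewrite !coind_add addrACA.
Defined.
Definition coind_opp (f : coind) : coind.
Proof. by exists (fun x r => - f x r) => x r s; rewrite coind_add opprD. Defined.
Definition coind_zero : coind.
Proof. by exists (fun x r => 0) => x r s; rewrite addr0. Defined.
Definition coind_scale (a : R) (f : coind) : coind.
Proof. by exists (fun x r => f x (r * a)) => x r s; rewrite mulrDl coind_add. Defined.

Lemma coind_addA : associative coind_addf.
Proof. by move=> f g h; apply: coind_eq => x r /=; rewrite addrA. Qed.
Lemma coind_addC : commutative coind_addf.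
Proof. by move=> f g; apply: coind_eq => x r /=; rewrite addrC. Qed.
Lemma coind_add0 : left_id coind_zero coind_addf.
Proof. by move=> f; apply: coind_eq => x r /=; rewrite add0r. Qed.
Lemma coind_addN : left_inverse coind_zero coind_opp coind_addf.
Proof. by move=> f; apply: coind_eq => x r /=; rewrite addNr. Qed.

HB.instance Definition _ := GRing.isZmodule.Build coind
  coind_addA coind_addC coind_add0 coind_addN.

Lemma coind_scaleA a b f :
  coind_scale a (coind_scale b f) = coind_scale (a * b) f.
Proof. by apply: coind_eq => x r /=; rewrite mulrA. Qed.
Lemma coind_scale1 : left_id 1 coind_scale.
Proof. by move=> f; apply: coind_eq => x r /=; rewrite mulr1. Qed.
Lemma coind_scaleDr : right_distributive coind_scale +%R.
Proof. by move=> a f g; apply: coind_eq. Qed.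
Lemma coind_scaleDl f : {morph coind_scale^~ f : a b / a + b}.
Proof. by move=> a b; apply: coind_eq => x r /=; rewrite mulrDr coind_add. Qed.

HB.instance Definition _ := GRing.Zmodule_isLmodule.Build R coind
  coind_scaleA coind_scale1 coind_scaleDr coind_scaleDl.

Lemma coindDE (f g : coind) x r : (f + g) x r = f x r + g x r.
Proof. by []. Qed.
Lemma coindZE a (f : coind) x r : (a *: f) x r = f x (r * a).
Proof. by []. Qed.

End Coinduced.

Lemma additive_linearz (U : zmodType) (V : lmodType int) (f : U -> V) :
  {morph f : x y / x + y} -> linear (f : zmodule U -> V).
Proof.
move=> fD; have f0 : f 0 = 0.
  by apply: (addrI (f 0)); rewrite -fD !addr0.
have fN x : f (- x) = - f x.
  by apply/eqP; rewrite -addr_eq0 -fD addNr f0.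
have fMn x n : f (x *+ n) = f x *+ n.
  by elim: n => [|n IH]; rewrite ?mulr0n // !mulrS fD IH.
move=> a x y; rewrite fD; congr (_ + _).
rewrite scalezrE -[a in RHS]intz scaler_int.
by case: a => n; rewrite -?pmulrn ?NegzE ?mulrNz -?pmulrn ?fN fMn.
Qed.

Section EnoughInjectives.
Variable R : comNzRingType.

(** Evaluation at 1 identifies linear maps from A to Hom_Z(R, Q/Z) with additive maps from A to Q/Z.
    So each component of g is extended over Z, and the extension is turned back into a linear map by
    b |-> (r |-> h (r b)). *)
Lemma coind_injective (X : Type) : injective_module (coind R X).
Proof.
move=> A B f g finj.
have f_lin : linear (f : zmodule A -> zmodule B).
  by apply: additive_linearz => x y; exact: linearD.
have g_lin x : linear (fun a : zmodule A => (g a : coind R X) x 1).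
  by apply: additive_linearz => a b; rewrite linearD.
have hx x : exists h : {linear zmodule B -> QZ}, forall a, h (f a) = g a x 1.
  have [|h hE] := QZ_injective (f := mklin f_lin) (mklin (g_lin x)).
    exact: finj.
  by exists h.
have [h hE] := choice hx.
have Hadd (b : B) x : {morph (fun r => h x (r *: b)) : r s / r + s}.
  by move=> r s; rewrite scalerDl; exact: (linearD (h x)).
pose H (b : B) : coind R X := Coind (Hadd b).
have H_lin : linear H.
  move=> a b c; apply: coind_eq => x r; rewrite coindDE coindZE /=.
  rewrite scalerDr scalerA; exact: (linearD (h x)).
exists (mklin H_lin) => a; rewrite mklinE; apply: coind_eq => x r /=.
by rewrite -linearZZ hE linearZZ coindZE mul1r.
Qed.

(** The product has one factor for each x in V, given by an additive map [s x] to Q/Z that does not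
    vanish at x when x is nonzero. A nonzero v is then detected by its own factor, evaluated at
    1. *)
Lemma enough_injectives (V : lmodType R) :
  exists (E : lmodType R) (f : {linear V -> E}),
    injective_module E /\ injective f.
Proof.
have sep (v : V) : exists s : {linear zmodule V -> QZ}, v != 0 -> s v <> 0.
  have [->|v0] := eqVneq v 0; first by exists (zero_map (zmodule V) QZ).
  by have [s sv] := @QZ_separates (zmodule V) v v0; exists s.
have [s sP] := choice sep.
have Fadd (v x : V) : {morph (fun r => s x (r *: v)) : r t / r + t}.
  by move=> r t; rewrite scalerDl; exact: (linearD (s x)).
pose F (v : V) : coind R V := Coind (Fadd v).
have F_lin : linear F.
  move=> a b c; apply: coind_eq => x r; rewrite coindDE coindZE /=.
  rewrite scalerDr scalerA; exact: (linearD (s x)).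
exists (coind R V), (mklin F_lin); split; first exact: coind_injective.
apply: inj_of_ker0 => v Fv; apply/eqP; apply: contrapT => /negP v0.
apply: (sP v v0); have : F v v 1 = (0 : coind R V) v 1 by rewrite -Fv.
by rewrite /= scale1r.
Qed.

Lemma injective_hull (V : lmodType R) :
  exists (E : lmodType R) (f : {linear V -> E}),
    [/\ injective_module E, injective f & essential (im_pred f)].
Proof.
have [E [f [injE finj]]] := enough_injectives V.
have [H [fH injH Hess]] := inj_hull injE (im_pred f).
have fH' x : f x \in H by apply: fH; apply/asboolP; exists x.
exists (submod H), (corestr fH'); split=> //.
  by apply: inj_of_ker0 => x /(congr1 val) /=; rewrite -(linear0 f) => /finj.
move=> S [x xS x0]; have [|r rx rx0] := Hess (val x) (valP x).
  by move=> e; move/eqP: x0; apply; apply: val_inj.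
exists (r *: x); split.
- exact: rpredZ.
- case/asboolP: rx => v vE; apply/asboolP; exists v; exact: val_inj.
- by apply/eqP => /(congr1 val).
Qed.
End EnoughInjectives.

(** * Minimal injective resolutions *)

Section Exactness.
Variables (R : comNzRingType) (C : complex R).

(* Quantifying over the neighbouring degrees [i] and [k] up to propositional
   equality avoids transports. *)
Definition exact_at (j : int) : Prop :=
  forall i k : int, j = i + 1 -> k = j + 1 ->
  forall x : C j, diff C j k x = 0 -> exists y : C i, diff C i j y = x.

Lemma cohomology_class0 (j : int) (x : submod (cocycles C j)) :
  quotmod_class (coboundaries C j) x = 0 <->
  exists y, diff C (j - 1) j y = val x.
Proof.
by split=> [/quotmod_class0/asboolP|h]; last exact/quotmod_class0/asboolP.
Qed.

Lemma cohomology_eq0 (j : int) : is_zero (cohomology C j) <-> exact_at j.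
Proof.
split=> [H0 i k ji kj x dx|ex X].
  have xZ : x \in cocycles C j by rewrite in_ker; move: dx; rewrite kj => ->.
  have /cohomology_class0[y yE] :=
    H0 (quotmod_class _ (exist _ x xZ : submod (cocycles C j))).
  by have -> : i = j - 1 by [lia]; exists y.
have [x ->] := quotmodP X; apply/cohomology_class0.
by apply: (ex _ (j + 1)) => //; [rewrite subrK | exact/eqP/(valP x)].
Qed.
End Exactness.

Section MinimalResolution.
Variable R : comNzRingType.

Definition hull (V : lmodType R) : lmodType R := projT1 (cid (injective_hull V)).
Definition hull_in (V : lmodType R) : {linear V -> hull V} :=
  projT1 (cid (projT2 (cid (injective_hull V)))).

Lemma hullP (V : lmodType R) : [/\ injective_module (hull V),
  injective (@hull_in V) & essential (im_pred (@hull_in V))].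
Proof. exact: projT2 (cid (projT2 (cid (injective_hull V)))). Qed.

Variable N : lmodType R.

Fixpoint cosyzygy (n : nat) : lmodType R :=
  if n is k.+1 then quotmod (im_pred (@hull_in (cosyzygy k))) else N.

Definition res_obj (n : nat) : lmodType R := hull (cosyzygy n).

Definition res_next (n : nat) : {linear res_obj n -> res_obj n.+1} :=
  @hull_in (cosyzygy n.+1) \o quotmod_class (im_pred (@hull_in (cosyzygy n))).

Lemma res_next_eq0 n x :
  res_next n x = 0 <-> exists y, @hull_in (cosyzygy n) y = x.
Proof.
have [_ hinj _] := hullP (cosyzygy n.+1).
split=> [|[y <-]]; rewrite /res_next /=.
  by rewrite -(linear0 (@hull_in (cosyzygy n.+1))) => /hinj/quotmod_class0/asboolP.
rewrite (_ : quotmod_class _ _ = 0) ?linear0 //.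
by apply/quotmod_class0/asboolP; exists y.
Qed.

(** A complex asks for a map between any two degrees; deciding n.+1 = m confines the transport to
    this definition. *)
Definition res_diff_nat (n m : nat) : {linear res_obj n -> res_obj m} :=
  match @eqP _ n.+1 m with
  | ReflectT e => match e in _ = k return {linear res_obj n -> res_obj k} with
                  | erefl => res_next n
                  end
  | ReflectF _ => zero_map (res_obj n) (res_obj m)
  end.

Lemma res_diff_natS n : res_diff_nat n n.+1 = res_next n.
Proof.
by rewrite /res_diff_nat; case: eqP => // e; rewrite (eq_irrelevance e erefl).
Qed.

Lemma res_diff_nat0 n m x : m <> n.+1 -> res_diff_nat n m x = 0.
Proof. by rewrite /res_diff_nat; case: eqP => // e; case: _ / e. Qed.

(** The 0 by 0 matrices serve as the zero module in negative degrees. *)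
Definition res_int (i : int) : lmodType R :=
  if i is Posz n then res_obj n else 'M[R]_(0, 0).

Definition res_diff (i j : int) : {linear res_int i -> res_int j} :=
  match i, j return {linear res_int i -> res_int j} with
  | Posz n, Posz m => res_diff_nat n m
  | i, j => zero_map (res_int i) (res_int j)
  end.

Lemma res_diff_shape i j : j != i + 1 -> forall x, res_diff i j x = 0.
Proof.
case: i j => [n|n] [m|m] //= mn x; rewrite res_diff_nat0 // => mE.
by move: mn; rewrite mE; lia.
Qed.

Lemma res_diff_comp i j k x : res_diff j k (res_diff i j x) = 0.
Proof.
case: i j k x => [n|n] [m|m] [k|k] //= x; rewrite ?linear0 //.
have [mE|mn] := pselect (m = n.+1); last by rewrite (res_diff_nat0 x) ?linear0.
have [kE|km] := pselect (k = m.+1); last by rewrite res_diff_nat0.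
rewrite {m}mE in kE *; rewrite {k}kE !res_diff_natS; apply/res_next_eq0.
by rewrite /res_next /=; eexists.
Qed.

Definition res_complex : complex R := Complex res_diff_shape res_diff_comp.
Definition res_augmented : augmented N :=
  @Augmented R N res_complex (@hull_in N).

Lemma res_cocycle (n : nat) k (x : res_complex n) : k = n%:Z + 1 ->
  diff res_complex n k x = 0 <-> exists y, @hull_in (cosyzygy n) y = x.
Proof.
by move=> kE; have {kE}-> : k = n.+1 by [lia]; rewrite /= res_diff_natS res_next_eq0.
Qed.

Lemma res_minimal : minimal_injective_resolution res_augmented.
Proof.
split; first split.
- case=> n; first by case: (hullP (cosyzygy n)).
  by move=> A B f g _; exists (zero_map B 'M[R]_(0, 0)) => x; rewrite [RHS]flatmx0 flatmx0.
- by case=> n // _ x; rewrite [LHS]flatmx0 [RHS]flatmx0.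
- by case: (hullP N).
- by move=> x; apply: (@res_cocycle 0).
- case=> [[|n]|n] // _; apply/cohomology_eq0 => i k iE kE x.
  have {iE}-> : i = n by lia.
  case/(res_cocycle x kE) => y <- /=; rewrite res_diff_natS.
  by have [z ->] := quotmodP y; exists z.
- case=> n S [x xS x0]; last by rewrite [x]flatmx0 [X in _ != X]flatmx0 eqxx in x0.
  have [_ _ ess] := hullP (cosyzygy n).
  have [|y [yS /asboolP yI y0]] := ess S; first by exists x.
  by exists y; split=> //; rewrite in_ker; apply/eqP/(@res_cocycle n).
Qed.
End MinimalResolution.

Lemma Einj_minimal (R : comNzRingType) (N : lmodType R) :
  minimal_injective_resolution (Einj N).
Proof.
rewrite /Einj /choose_or; case: pselect => [ex|[]]; first exact: projT2 (cid ex).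
by exists (res_augmented N); apply: res_minimal.
Qed.

(** * Contractions and cones *)

Definition bounded_below (R : comNzRingType) (C : complex R) : Prop :=
  exists b : int, forall i, i < b -> is_zero (C i).

(** Induction on the degree, starting where the complex is zero. Given h one degree lower, 1 - d h
    vanishes on the image of d, which by exactness is the kernel of the next d. Injectivity of [C i]
    therefore gives h' with h' d = 1 - d h, whence d h' d = d. Only exactness below j enters, so the
    lemma also applies to a complex that is exact up to some degree. *)
Lemma contraction (R : comNzRingType) (C : complex R) (i j : int) :
  (forall k, injective_module (C k)) -> bounded_below C -> j = i + 1 ->
  (forall k, k < j -> exact_at C k) ->
  exists h : {linear C j -> C i},
    forall y, diff C i j (h (diff C i j y)) = diff C i j y.
Proof.
move=> injC [b Cb].
suff main (n : nat) : forall i j, i = b - 1 + n%:Z -> j = i + 1 ->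
    (forall k, k < j -> exact_at C k) ->
    exists h : {linear C j -> C i},
      forall y, diff C i j (h (diff C i j y)) = diff C i j y.
  move=> ji ex; have [ib|bi] := leP b i.
    by apply: (main `|(i - (b - 1))%R|%N i j _ ji ex); lia.
  exists (zero_map (C j) (C i)) => y.
  by rewrite [y in RHS]Cb // !linear0.
elim: n => [|n IH] {}i {}j iE jE ex.
  exists (zero_map (C j) (C i)) => y.
  by rewrite [y in RHS]Cb ?linear0 //; lia.
have [||k kj|h hE] := IH (i - 1) i; [by lia | by lia | by apply: ex; lia|].
have g_lin : linear (fun y : C i => y - diff C (i - 1) i (h y)).
  by move=> a x y; rewrite !linearP /= addrACA scalerDr.
have [y|h' h'E] := inj_factor (injC i) (f := diff C i j) (g := mklin g_lin).
  move=> dy; have [||x <-] := ex i _ (i - 1) j _ jE y dy; [lia|lia|].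
  by rewrite mklinE hE subrr.
by exists h' => y; rewrite h'E mklinE linearB diff_comp subr0.
Qed.

(** If a torsion element x equals d y, then y may fail to be torsion; but h x is torsion, and d (h
    x) = d h d y = x. *)
Lemma Gamma_exact (R : comNzRingType) (J : {pred R}) (C : complex R) :
  (forall k, injective_module (C k)) -> bounded_below C ->
  (forall k, exact_at C k) -> forall k, exact_at (Gamma_complex J C) k.
Proof.
move=> injC Cb ex j i k jE kE x /(congr1 val) /= dx.
have [h hE] := contraction injC Cb jE (fun k _ => ex k).
have [y yE] := ex j i k jE kE _ dx.
by exists (Gamma_map J h x); apply: val_inj; rewrite /= -yE hE.
Qed.

Lemma cmap_commE (R : comNzRingType) (c : int) (L D : complex R)
    (f : cmap c L D) (i j i' j' : int) (x : L i) :
  i' = i + 1 -> j = i + c -> j' = j + 1 ->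
  f i' j' (diff L i i' x) = diff D j j' (f i j x).
Proof.
move=> -> -> ->; have -> : i + c + 1 = i + 1 + c by lia.
exact: cmap_comm.
Qed.

Section Cone.
Variables (R : comNzRingType) (c : int) (L D : complex R) (f : cmap c L D).

(** The mapping cone of f viewed as a morphism from L to D[c], where D[c] keeps the differential of
    D without sign, as in [cmap]. *)
Definition cone_obj (i : int) : lmodType R := (L (i + 1)%R * D (i + c)%R)%type.

Definition cone_fun (i j : int) (p : cone_obj i) : cone_obj j :=
  (- diff L (i + 1) (j + 1) p.1,
   f (i + 1) (j + c) p.1 + diff D (i + c) (j + c) p.2).

Lemma cone_linear i j : linear (@cone_fun i j).
Proof.
move=> a x y; rewrite /cone_fun /= !linearP /=; congr (_, _).
by rewrite /= scalerDr addrACA.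
Qed.

Definition cone_diff i j : {linear cone_obj i -> cone_obj j} :=
  mklin (@cone_linear i j).

Lemma cone_shape i j : j != i + 1 -> forall x, cone_diff i j x = 0.
Proof.
move=> ji x; rewrite mklinE /cone_fun.
rewrite diff_shape 1?cmap_shape 1?diff_shape ?oppr0 ?addr0 //; lia.
Qed.

Lemma cone_comp i j k x : cone_diff j k (cone_diff i j x) = 0.
Proof.
have [jE|ji] := eqVneq j (i + 1); last by rewrite (cone_shape ji) linear0.
have [kE|kj] := eqVneq k (j + 1); last by rewrite cone_shape.
rewrite !mklinE /cone_fun /=; congr (_, _).
  by rewrite linearN diff_comp !oppr0.
rewrite linearD diff_comp addr0 linearN.
by rewrite (@cmap_commE _ _ _ _ _ _ (j + c)) ?addNr //; lia.
Qed.

Definition cone : complex R := Complex cone_shape cone_comp.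

(** [qsurj] and [qinj] express surjectivity and injectivity of f on cohomology in degree i in terms
    of cocycles. Neighbouring degrees are variables, as in [exact_at]. *)
Definition qsurj (i : int) : Prop :=
  forall i1 j0 j j1, i1 = i + 1 -> j = i + c -> j = j0 + 1 -> j1 = j + 1 ->
  forall x : D j, diff D j j1 x = 0 ->
  exists (l : L i) (y : D j0), diff L i i1 l = 0 /\ x = f i j l + diff D j0 j y.

Definition qinj (i : int) : Prop :=
  forall i0 i1 j0 j, i = i0 + 1 -> i1 = i + 1 -> j = i + c -> j = j0 + 1 ->
  forall (l : L i) (y : D j0), diff L i i1 l = 0 -> f i j l = diff D j0 j y ->
  exists l', l = diff L i0 i l'.

(** This lemma and the next two are the pieces used of the long exact sequence H^i(L) -> H^i(D[c])
    -> H^i(cone) -> H^(i+1)(L) -> H^(i+1)(D[c]). *)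
Lemma cone_exact i : qsurj i -> qinj (i + 1) -> exact_at cone i.
Proof.
move=> fS fI i0 k iE kE; subst k i => -[l x].
rewrite /= mklinE /cone_fun /= => -[/eqP]; rewrite oppr_eq0 => /eqP dl fl.
have e1 : i0 + 1 + 1 + c = i0 + 1 + c + 1 by lia.
have e2 : i0 + 1 + c = i0 + c + 1 by lia.
have [|l' lE] := fI _ _ _ _ erefl erefl erefl e1 l (- x) dl.
  by rewrite linearN; apply: subr0_eq; rewrite opprK.
have [|l2 [y [dl2 xE]]] := fS _ _ _ _ erefl erefl e2 e1
    (x + f (i0 + 1) (i0 + 1 + c) l').
  by rewrite linearD -(@cmap_commE _ _ _ _ _ _ _ (i0 + 1 + 1)) // -lE [LHS]addrC.
exists (l2 - l', y); rewrite mklinE /cone_fun /=; congr (_, _).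
  by rewrite [diff _ _ _ _]linearB dl2 sub0r opprK -lE.
by rewrite linearB [LHS]addrAC -xE addrK.
Qed.

Lemma cone_qsurj i : exact_at cone i -> qsurj i.
Proof.
move=> ex i1 j0 j j1 i1E jE j0E j1E x dx.
have [i0 iE] : exists i0, i = i0 + 1 by exists (i - 1); lia.
have {}j0E : j0 = i0 + c by lia.
have {}j1E : j1 = i + 1 + c by lia.
subst j0 j1 i1 j; subst i.
have [|||[l y]] := ex i0 (i0 + 1 + 1) _ _ (0, x) _ => //.
  by rewrite /= mklinE /cone_fun /= dx !linear0 addr0.
rewrite /= mklinE /cone_fun /= => -[/eqP]; rewrite oppr_eq0 => /eqP dl <-.
by exists l, y.
Qed.

Lemma cone_qinj i : exact_at cone i -> qinj (i + 1).
Proof.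
move=> ex i0 i1 j0 j i0E i1E jE j0E l y dl fl.
have {}i0E : i0 = i by lia.
have {}j0E : j0 = i + c by lia.
subst i0 j0 i1 j.
have [i0 iE] : exists i0, i = i0 + 1 by exists (i - 1); lia.
have [||[l' y']] := ex i0 (i + 1) iE _ (l, - y) _ => //.
  by rewrite /= mklinE /cone_fun /= dl fl linearN oppr0 subrr.
rewrite /= mklinE /cone_fun /= => -[<- _]; subst i.
by exists (- l'); rewrite linearN.
Qed.
End Cone.

Lemma bijective_cohomology_map (R : comNzRingType) (c : int) (L D : complex R)
    (f : cmap c L D) (i : int) :
  bijective (cohomology_map f i) <-> qsurj f i /\ qinj f i.
Proof.
have mapE x : cohomology_map f i (quotmod_class (coboundaries L i) x) =
    quotmod_class (coboundaries D (i + c)) (cocycles_map f i x).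
  exact: (quotmod_map_class (@cmap_coboundaries _ _ _ _ f i)).
split=> [[g fK gK]|[fS fI]].
  split=> [i1 j0 j j1 i1E jE j0E j1E x dx|i0 i1 j0 j i0E i1E jE j0E l y dl fl].
    have {}j0E : j0 = i + c - 1 by lia.
    subst j0 j1 i1 j.
    have xZ : x \in cocycles D (i + c) by rewrite in_ker dx.
    pose X : cohomology D (i + c) :=
      quotmod_class _ (exist _ x xZ : submod (cocycles D (i + c))).
    have [l lE] := quotmodP (g X); have := gK X; rewrite lE mapE.
    move/quotmod_classP/asboolP => [y /= yE].
    exists (val l), (- y); split; first exact/eqP/(valP l).
    by rewrite linearN yE /= opprB [RHS]addrC subrK.
  have {}j0E : j0 = i + c - 1 by lia.
  have {}i0E : i0 = i - 1 by lia.
  subst i0 j0 i1 j.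
  have lZ : l \in cocycles L i by rewrite in_ker dl.
  pose l' : submod (cocycles L i) := exist _ l lZ.
  have /cohomology_class0[l2 l2E] : quotmod_class (coboundaries L i) l' = 0.
    apply: (can_inj fK); rewrite linear0 mapE; apply/cohomology_class0.
    by exists y.
  by exists l2.
have finj : injective (cohomology_map f i).
  apply: inj_of_ker0 => X; have [l ->] := quotmodP X.
  rewrite mapE => /cohomology_class0[y yE]; apply/cohomology_class0.
  have e1 : i = i - 1 + 1 by lia.
  have e2 : i + c = i + c - 1 + 1 by lia.
  have dl : diff L i (i + 1) (val l) = 0 by exact/eqP/(valP l).
  have [|l' lE] := fI _ _ _ _ e1 erefl erefl e2 (val l) y dl; first by rewrite yE.
  by exists l'.
have fsurj Y : exists X, cohomology_map f i X = Y.
  have [x ->] := quotmodP Y.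
  have e2 : i + c = i + c - 1 + 1 by lia.
  have dx : diff D (i + c) (i + c + 1) (val x) = 0 by exact/eqP/(valP x).
  have [l [y [dl xE]]] := fS _ _ _ _ erefl erefl e2 erefl (val x) dx.
  have lZ : l \in cocycles L i by rewrite in_ker dl.
  exists (quotmod_class _ (exist _ l lZ : submod (cocycles L i))).
  rewrite mapE; apply/quotmod_classP/asboolP; exists (- y).
  by rewrite linearN /= xE opprD addrA subrr add0r.
have [g gE] := choice fsurj.
by exists g => // X; apply: finj; rewrite gE.
Qed.

Section TorsionCone.
Variables (R : comNzRingType) (J : {pred R}).

Lemma torsion_pair (U V : lmodType R) (x : U) (y : V) :
  x \in @torsion_pred R J U -> y \in @torsion_pred R J V ->
  (x, y) \in @torsion_pred R J (U * V)%type.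
Proof.
move=> xT yT; rewrite (_ : (x, y) = (x, 0) + (0, y)); last first.
  by congr (_, _); rewrite /= ?addr0 ?add0r.
apply: rpredD; [case/asboolP: xT|case/asboolP: yT] => n nT; apply/asboolP;
  by exists n => a aJ; congr (_, _); rewrite /= ?nT ?scaler0.
Qed.

Lemma torsion_fst (U V : lmodType R) (p : U * V) :
  p \in @torsion_pred R J (U * V)%type -> p.1 \in @torsion_pred R J U.
Proof. exact: (torsion_map fst). Qed.

Lemma torsion_snd (U V : lmodType R) (p : U * V) :
  p \in @torsion_pred R J (U * V)%type -> p.2 \in @torsion_pred R J V.
Proof. exact: (torsion_map snd). Qed.

Variables (c : int) (L D : complex R) (f : cmap c L D).

(** Torsion commutes with finite products, so the two complexes are canonically isomorphic. They are
    not equal as types, and only the transfer of exactness is recorded. *)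
Lemma cone_Gamma_exact (i : int) :
  exact_at (Gamma_complex J (cone f)) i <-> exact_at (cone (Gamma_cmap J f)) i.
Proof.
split=> ex i0 k iE kE.
  move=> [l x]; rewrite /= mklinE /cone_fun /= => -[dl dx].
  pose z : Gamma_complex J (cone f) i :=
    exist _ (val l, val x) (torsion_pair (valP l) (valP x)).
  have [|y /(congr1 val)/= yE] := ex i0 k iE kE z.
    by apply: val_inj; rewrite /= mklinE /cone_fun /= dl dx.
  exists (exist _ (val y).1 (torsion_fst (valP y)),
          exist _ (val y).2 (torsion_snd (valP y))).
  by move: yE; rewrite /= !mklinE /cone_fun /= => -[lE xE]; congr (_, _); apply: val_inj.
move=> z /(congr1 val); rewrite /= mklinE /cone_fun /= => -[dl dx].
pose w : cone (Gamma_cmap J f) i := (exist _ (val z).1 (torsion_fst (valP z)),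
  exist _ (val z).2 (torsion_snd (valP z))).
have [|[l x]] := ex i0 k iE kE w.
  by rewrite /= mklinE /cone_fun /=; congr (_, _); apply: val_inj.
rewrite /= mklinE /cone_fun /= => -[lE xE].
exists (exist _ (val l, val x) (torsion_pair (valP l) (valP x))).
by apply: val_inj; rewrite /= mklinE /cone_fun /= /= lE xE; case: (val z).
Qed.

Lemma cone_injective :
  (forall i, injective_module (L i)) -> (forall i, injective_module (D i)) ->
  forall i, injective_module (cone f i).
Proof. by move=> injL injD i; apply: inj_prod. Qed.

Lemma cone_bounded_below :
  bounded_below L -> bounded_below D -> bounded_below (cone f).
Proof.
move=> [b Lb] [e De]; exists (Num.min (b - 1) (e - c)) => i.
rewrite lt_min => /andP[ib ie] [l x]; congr (_, _).
  by apply: Lb; lia.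
by apply: De; lia.
Qed.

Lemma quasi_iso_Gamma :
  (forall i, injective_module (L i)) -> (forall i, injective_module (D i)) ->
  bounded_below L -> bounded_below D ->
  (forall i, qsurj f i) -> (forall i, qinj f i) ->
  forall i, qsurj (Gamma_cmap J f) i /\ qinj (Gamma_cmap J f) i.
Proof.
move=> injL injD Lb Db fS fI i.
have ex k : exact_at (cone (Gamma_cmap J f)) k.
  apply/cone_Gamma_exact/Gamma_exact.
  - exact: cone_injective.
  - exact: cone_bounded_below.
  - by move=> j; apply: cone_exact.
split; first exact: cone_qsurj.
by rewrite -[i](subrK 1); apply: cone_qinj.
Qed.
End TorsionCone.

(** * Comparison maps *)

Section ComparisonMap.
Variable R : comNzRingType.

Lemma dependent_choice (T : Type) (P : nat -> T -> Prop)
    (Q : nat -> T -> T -> Prop) (x0 : T) :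
  P 0%N x0 -> (forall n x, P n x -> exists y, P n.+1 y /\ Q n x y) ->
  exists s : nat -> T, s 0%N = x0 /\ forall n, P n (s n) /\ Q n (s n) (s n.+1).
Proof.
move=> P0 PS.
have [next nextP] := choice (fun x : {p : nat * T | P p.1 p.2} =>
  PS (sval x).1 (sval x).2 (svalP x)).
pose step (x : {p : nat * T | P p.1 p.2}) : {p : nat * T | P p.1 p.2} :=
  exist _ ((sval x).1.+1, next x) (nextP x).1.
pose s n := iter n step (exist _ (0%N, x0) P0).
have s1 n : (sval (s n)).1 = n by elim: n => //= n ->.
exists (fun n => (sval (s n)).2); split=> // n.
have [_ +] := nextP (s n); rewrite s1 => Qn.
by split=> //; have := svalP (s n); rewrite s1.
Qed.

(** Extension by zero: the components of a comparison map are built one at a time, whereas a [cmap]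
    is a family over all pairs of degrees. *)
Lemma linear_family (L D : int -> lmodType R) (i0 j0 : int)
    (u : {linear L i0 -> D j0}) :
  exists g : forall i j, {linear L i -> D j},
    (forall x, g i0 j0 x = u x) /\
    forall i j, ~ (i = i0 /\ j = j0) -> forall x, g i j x = 0.
Proof.
pose g i j : {linear L i -> D j} :=
  match @eqP _ i0 i, @eqP _ j0 j with
  | ReflectT e, ReflectT e' =>
    match e in _ = i, e' in _ = j return {linear L i -> D j} with
    | erefl, erefl => u
    end
  | _, _ => zero_map (L i) (D j)
  end.
exists g; split=> [x|i j ij x]; rewrite /g; case: eqP => // e; case: eqP => // e'.
  by rewrite (eq_irrelevance e erefl) (eq_irrelevance e' erefl).
by case: ij; rewrite -e -e'.
Qed.

Lemma comparison_map (L D : complex R) (c : int) (H : lmodType R)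
    (a : {linear H -> L 0}) (u : {linear H -> D c}) :
  injective a -> (forall x, diff L 0 1 x = 0 -> exists h, a h = x) ->
  (forall i, i < 0 -> is_zero (L i)) -> (forall i, 0 < i -> exact_at L i) ->
  (forall i, injective_module (D i)) ->
  (forall h, diff D c (c + 1) (u h) = 0) ->
  exists phi : cmap c L D, forall h, phi 0 c (a h) = u h.
Proof.
move=> ainj aker L0 Lex injD du.
have [h|u0 u0E] := inj_factor (injD c) (f := a) (g := u).
  by rewrite -(linear0 a) => /ainj ->; rewrite linear0.
have [g0 [g0E g0z]] := linear_family u0.
(* Stage n carries the single component in degree n. Besides this, [P] records that d g vanishes on
   cocycles, which is what the next component needs in order to be defined; [Q] is the commuting
   square. *)
pose P (n : nat) (g : forall i j, {linear L i -> D j}) :=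
  (forall i j : int, ~ (i = n%:Z /\ j = n%:Z + c) -> forall x, g i j x = 0) /\
  forall x, diff L n n.+1 x = 0 ->
    diff D (n%:Z + c) (n.+1%:Z + c) (g n (n%:Z + c) x) = 0.
pose Q (n : nat) (g g' : forall i j, {linear L i -> D j}) :=
  forall x, g' n.+1 (n.+1%:Z + c) (diff L n n.+1 x) =
    diff D (n%:Z + c) (n.+1%:Z + c) (g n (n%:Z + c) x).
have [||s [s0 sP]] := @dependent_choice _ P Q g0.
- split; first by move=> i j; rewrite add0r; apply: g0z.
  rewrite add0r => x /aker[h <-]; rewrite g0E u0E.
  by have -> : 1%:Z + c = c + 1 by lia.
- move=> n g [gz gd].
  have [|v vE] := inj_factor (injD (n.+1%:Z + c)) (f := diff L n n.+1)
      (g := diff D (n%:Z + c) (n.+1%:Z + c) \o g n (n%:Z + c)).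
    exact: gd.
  have [g' [g'E g'z]] := linear_family v; exists g'; split; last first.
    by move=> x; rewrite g'E vE.
  split; first exact: g'z.
  move=> x dx; have [|||y <-] := Lex n.+1 _ n n.+2 _ _ x dx; try lia.
  by rewrite g'E vE /= diff_comp.
have sz (n : nat) (i j : int) : ~ (i = n%:Z /\ j = n%:Z + c) -> forall x, s n i j x = 0.
  by have [[sz _] _] := sP n; apply: sz.
(* For negative i this is zero, since stage |i| is concentrated in degree |i|. *)
pose phi i j := s `|i|%N i j.
have phi_shape i j : j != i + c -> forall x, phi i j x = 0.
  by move=> /eqP ji; apply: sz => -[iE jE]; apply: ji; rewrite jE iE.
have phi_comm i (x : L i) : phi (i + 1) (i + 1 + c) (diff L i (i + 1) x) =
    diff D (i + c) (i + 1 + c) (phi i (i + c) x).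
  case: i x => n x; last by rewrite [x]L0 ?linear0.
  have -> : n%:Z + 1 = n.+1 by lia.
  by have [_ sQ] := sP n; apply: sQ.
exists (CMap phi_shape phi_comm) => h /=.
by rewrite /phi /= s0 g0E u0E.
Qed.
End ComparisonMap.

(** * Torsion over Noetherian rings *)

Section Noetherian.
Variables (R : comNzRingType).

(** The union of the chain is an ideal. Each of its finitely many generators lies in some member,
    and the largest of these members is the whole union. *)
Lemma noetherian_chain (T : Type) (B : T -> R -> Prop) :
  noetherian R -> inhabited T ->
  (forall t, is_submod (B t : R^o -> Prop)) ->
  (forall s t, (forall a, B s a -> B t a) \/ (forall a, B t a -> B s a)) ->
  exists t, forall s a, B s a -> B t a.
Proof.
move=> noeth [t0] Bsub Btot.
have Usub : is_submod (fun a : R^o => exists t, B t a).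
  split.
  - by exists t0; have [] := Bsub t0.
  - move=> a b [s sa] [t tb].
    have [st|ts] := Btot s t; [exists t|exists s].
      by have [_ + _] := Bsub t; apply=> //; apply: st.
    by have [_ + _] := Bsub s; apply=> //; apply: ts.
  - by move=> r a [s sa]; exists s; have [_ _] := Bsub s; apply.
have [n [g gP]] := noeth (mksub Usub).
have gU k : exists t, B t (g k).
  apply/(mksubP Usub)/gP; exists (fun j => (j == k)%:R).
  rewrite (bigD1 k) //= eqxx scale1r big1 ?addr0 // => j /negPf ->.
  exact: scale0r.
have [t tP] : exists t, forall k, k \in enum 'I_n -> B t (g k).
  elim: (enum 'I_n) => [|k s [t tP]]; first by exists t0.
  have [u uk] := gU k; have [ut|tu] := Btot u t; [exists t|exists u] => j.
    by rewrite in_cons => /orP[/eqP->|/tP//]; apply: ut.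
  by rewrite in_cons => /orP[/eqP->//|/tP]; apply: tu.
exists t => s a sa; have [_ tD tZ] := Bsub t.
have /gP[c ->] : (a : R^o) \in mksub Usub by apply/mksubP; exists s.
elim/big_ind: _ => // [|k _]; first by have [] := Bsub t.
by apply: tZ; apply: tP; rewrite mem_enum.
Qed.

Definition spanned (J : {pred R}) (n : nat) (g : 'I_n -> R) : Prop :=
  forall a, a \in J <-> exists c : 'I_n -> R, a = \sum_k c k * g k.

Lemma spanned_gen (J : {pred R}) n (g : 'I_n -> R) k : spanned J g -> g k \in J.
Proof.
move=> gP; apply/gP; exists (fun j => (j == k)%:R).
by rewrite (bigD1 k) //= eqxx mul1r big1 ?addr0 // => j /negPf ->; rewrite mul0r.
Qed.

Lemma noetherian_spanned (I : idealr R) : noetherian R ->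
  exists n (g : 'I_n -> R), spanned I g.
Proof.
move=> noeth; have Isub : is_submod (fun a : R^o => (a : R) \in I).
  split=> [|x y|a x]; [exact: idealr0|exact: rpredD|exact: idealMr].
have [n [g gP]] := noeth (mksub Isub).
exists n, g => a; split=> [aI|[c aE]].
  by apply/gP/mksubP.
by apply/(mksubP Isub)/gP; exists c.
Qed.

Lemma torsion_power (J : {pred R}) (M : lmodType R) (x : M) a :
  x \in @torsion_pred R J M -> a \in J -> exists n, a ^+ n *: x = 0.
Proof.
move=> /asboolP[n xn] aJ; exists n.
by have := xn (fun=> a) (fun=> aJ); rewrite prodr_const card_ord.
Qed.

(** Pigeonhole: if the N-th power of each of the n generators kills x, expand a product of n N + 1
    elements of J into monomials in the generators. In each monomial some generator occurs at least
    N times. *)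
Lemma torsion_spanned (J : {pred R}) n (g : 'I_n -> R) (M : lmodType R) (x : M) :
  spanned J g -> (forall k, exists e, g k ^+ e *: x = 0) ->
  x \in @torsion_pred R J M.
Proof.
move=> gP xT; have [e eP] := choice xT.
pose N := \max_k e k.
have NP k : g k ^+ N *: x = 0.
  have ekN : (e k <= N)%N by exact: leq_bigmax.
  by rewrite -(subnK ekN) exprD -scalerA eP scaler0.
apply/asboolP; exists (n * N).+1 => a aJ.
have [c cE] := choice (fun k => (gP _).1 (aJ k)).
under eq_bigr do rewrite cE.
rewrite bigA_distr_bigA scaler_suml big1 // => f _.
have [k kN] : exists k : 'I_n, (N <= #|[pred j | f j == k]|)%N.
  apply: contrapT => nex.
  have : (\sum_(k < n) #|[pred j | f j == k]| <= n * N)%N.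
    apply: (@leq_trans (\sum_(k < n) N)); last by rewrite sum_nat_const card_ord.
    apply: leq_sum => k _.
    by rewrite leqNgt; apply/negP => kN; apply: nex; exists k; apply: ltnW.
  suff -> : (\sum_(k < n) #|[pred j | f j == k]| = (n * N).+1)%N by rewrite ltnn.
  rewrite -[RHS]card_ord -sum1_card (partition_big f predT) //=.
  by apply: eq_bigr => k _; rewrite -sum1_card.
rewrite big_split /= -scalerA.
have -> : \prod_i g (f i) = \prod_(i | f i != k) g (f i) *
    g k ^+ (#|[pred j | f j == k]| - N) * g k ^+ N.
  rewrite (bigID (fun j => f j == k)) /= mulrC -mulrA -exprD subnK //.
  by congr (_ * _); rewrite -prodr_const; apply: eq_bigr => j /eqP ->.
by rewrite -scalerA NP !scaler0.
Qed.

End Noetherian.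

Section GammaInjective.
Variables (R : comNzRingType).

(* An essential extension of a J-torsion module is J-torsion, so the
   J-torsion part of an injective module is its own injective hull. *)
Lemma Gamma_injective (J : {pred R}) n (g : 'I_n -> R) (E : lmodType R) :
  noetherian R -> spanned J g -> injective_module E ->
  injective_module (Gamma J E).
Proof.
move=> noeth gP injE.
have [H [SH injH ess]] := inj_hull injE (@torsion_pred R J E).
suff HS x : x \in H -> x \in @torsion_pred R J E.
  have sH x : sub_val (@torsion_pred R J E) x \in H by apply: SH; apply: valP x.
  have sS x : sub_val H x \in @torsion_pred R J E by apply: HS; apply: valP x.
  by apply: (inj_retract (s := corestr sH) (r := corestr sS)) => // x; apply: val_inj.
move=> xH; apply: (torsion_spanned gP) => k.
(* The annihilators of g_k^j x become stationary at some j. If g_k^j x were nonzero, it would have a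
   nonzero torsion multiple r g_k^j x. A power of g_k kills this multiple, so r annihilates a later
   term, hence g_k^j x itself. *)
pose B (j : nat) (r : R) := (r * g k ^+ j) *: x = 0.
have Bmono i j r : (i <= j)%N -> B i r -> B j r.
  by rewrite /B => ij ri; rewrite -(subnK ij) exprD mulrCA -scalerA ri scaler0.
have [t|i j|j jP] := noetherian_chain (B := B) noeth (inhabits 0%N).
- split; rewrite /B.
  + by rewrite mul0r scale0r.
  + by move=> a b ax bx; rewrite mulrDl scalerDl ax bx addr0.
  + by move=> a b bx; rewrite -mulrA -scalerA bx scaler0.
- by have [ij|/ltnW ji] := leqP i j; [left|right] => a; apply: Bmono.
exists j; apply: contrapT => x0.
have [||r rS rx0] := ess (g k ^+ j *: x).
- exact: rpredZ.
- exact: x0.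
have [N] := torsion_power rS (spanned_gen k gP).
rewrite !scalerA => gx; apply: rx0; rewrite scalerA.
by apply: (jP (N + j)%N); rewrite /B exprD mulrCA mulrA.
Qed.
End GammaInjective.

(** * Associated primes *)

Section AssociatedPrime.
Variables (R : comNzRingType) (H : lmodType R).

Section Annihilator.
Variable x : H.
Definition ann_pred : {pred R} := fun r => `[< r *: x = 0 >].
Definition prime_ann : Prop :=
  x <> 0 /\ forall u v, (u * v) *: x = 0 -> v *: x <> 0 -> u *: x = 0.
Definition ann_prime_pred of prime_ann := ann_pred.
Variable xP : prime_ann.

Lemma ann_idealr_closed : idealr_closed (ann_prime_pred xP).
Proof.
split; first by apply/asboolP; rewrite scale0r.
  by apply/negP => /asboolP; rewrite scale1r; case: xP.
move=> a u v /asboolP ux /asboolP vx; apply/asboolP.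
by rewrite scalerDl -scalerA ux vx scaler0 addr0.
Qed.

Lemma ann_prime_closed : prime_idealr_closed (ann_prime_pred xP).
Proof.
move=> u v /asboolP uvx.
have [vx|vx] := pselect (v *: x = 0); first by apply/orP; right; apply/asboolP.
by apply/orP; left; apply/asboolP; case: xP => _; apply; first exact: uvx.
Qed.

HB.instance Definition _ := isIdealr.Build R (ann_prime_pred xP) ann_idealr_closed.
HB.instance Definition _ :=
  isPrimeIdealrClosed.Build R (ann_prime_pred xP) ann_prime_closed.
Definition ann_prime : prime_idealr R := ann_prime_pred xP.
End Annihilator.

(** A maximal annihilator of a nonzero element is prime: if u v kills x but v does not, the
    annihilators of x and of v x coincide, and u lies in the latter. *)
Lemma associated_prime : noetherian R -> ~ is_zero H ->
  exists (x : H) (p : prime_idealr R), x <> 0 /\ forall r, r \in p <-> r *: x = 0.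
Proof.
move=> noeth /existsNP[x0 /= x0n].
pose ann (x : H) : set R := fun r => r *: x = 0.
have [|F [X0 FX0] FP Ftot|A [x [xn AE]] Amax] := @zorn_nonempty_chain R
    (fun A => exists x, x <> 0 /\ A = ann x) (ann x0).
- by exists x0.
- have [X|X Y|[X FX] XP] := noetherian_chain
      (B := fun (X : {X | F X}) (a : R) => sval X a) noeth (inhabits (exist _ X0 FX0)).
  + have [x [_ ->]] := FP _ (svalP X); rewrite /ann.
    split; first by rewrite scale0r.
      by move=> a b ax bx; rewrite scalerDl ax bx addr0.
    by move=> a b bx; rewrite -[_ *: b]/(a * b) -scalerA bx scaler0.
  + by have [XY|YX] := Ftot _ _ (svalP X) (svalP Y); [left|right].
  + have [x [xn XE]] := FP _ FX; exists x; split=> //; rewrite -XE.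
    apply/seteqP; split=> [a [Y FY Ya]|a Xa]; last by exists X.
    exact: (XP (exist _ Y FY) a Ya).
have xP : prime_ann x.
  split=> // u v uvx vx; have : A u; last by rewrite AE.
  apply: (Amax (ann (v *: x))); first by exists (v *: x).
    by rewrite AE => r rx; rewrite /ann scalerA mulrC -scalerA rx scaler0.
  by rewrite /ann scalerA.
by exists x, (ann_prime xP); split=> // r; split=> [/asboolP|rx]; last exact/asboolP.
Qed.
End AssociatedPrime.

(** * Localization *)

Section LocalizationTheory.
Variables (R : comNzRingType) (p : prime_idealr R).
Implicit Types (M U V : lmodType R) (s t u : denom p).

Let A : comNzRingType := locring p.

Definition iota (a : R) : A := loc_frac (a : R^o) (denom1 p).

Lemma locDE M (x y : M) s t :
  loc_frac x s + loc_frac y t = loc_frac (dval t *: x + dval s *: y) (denomM s t).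
Proof. exact: loc_addE. Qed.

Lemma locZE M (a : R) (x : M) s t :
  (loc_frac (a : R^o) s : A) *: loc_frac x t = loc_frac (a *: x) (denomM s t).
Proof. exact: loc_scaleE. Qed.

Lemma loc_eq0 M (x : M) s : loc_frac x s = 0 <-> exists u, dval u *: x = 0.
Proof.
split=> [/eq_frac[u]|[u ux]].
  by rewrite dval1 mulr1 scaler0 => ux; exists u.
by apply/eq_frac; exists u; rewrite dval1 mulr1 scaler0.
Qed.

Lemma loc_cancel M (x : M) s u : loc_frac (dval u *: x) (denomM u s) = loc_frac x s.
Proof.
by apply/eq_frac; exists (denom1 p); rewrite dvalM !dval1 !mul1r scalerA mulrC.
Qed.

Lemma loc1_scale M (x : M) s a : iota a *: loc_frac x s = loc_frac (a *: x) s.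
Proof.
rewrite locZE; apply/eq_frac; exists (denom1 p).
by rewrite dvalM !dval1 !mul1r.
Qed.

Lemma loc1D M (x y : M) s : loc_frac x s + loc_frac y s = loc_frac (x + y) s.
Proof.
rewrite locDE -scalerDr; apply/eq_frac; exists (denom1 p).
by rewrite dvalM !dval1 !mul1r scalerA mulrC.
Qed.

Definition inv_den s : A := loc_frac (1 : R^o) s.

Lemma loc_split M (x : M) s : loc_frac x s = inv_den s *: loc_frac x (denom1 p).
Proof.
rewrite locZE scale1r; apply/eq_frac; exists (denom1 p).
by rewrite dvalM !dval1 !mul1r mulr1.
Qed.

Lemma loc_den_scale M (x : M) s : iota (dval s) *: loc_frac x s = loc_frac x (denom1 p).
Proof.
rewrite loc1_scale; apply/eq_frac; exists (denom1 p).
by rewrite !dval1 !mul1r scale1r.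
Qed.

Lemma inv_denK s : iota (dval s) * inv_den s = 1.
Proof. exact: (@loc_den_scale R^o 1 s). Qed.

Lemma iota_den_inj M (X : localization p M) s : iota (dval s) *: X = 0 -> X = 0.
Proof.
by move=> /(congr1 (fun Y => inv_den s *: Y)); rewrite scalerA mulrC inv_denK scale1r scaler0.
Qed.

Lemma iotaD a b : iota (a + b) = iota a + iota b.
Proof. by rewrite /iota [RHS]loc1D. Qed.

Lemma iotaM a b : iota (a * b) = iota a * iota b.
Proof. exact/esym/(@loc1_scale R^o b (denom1 p) a). Qed.

Lemma iota1 : iota 1 = 1. Proof. by []. Qed.

Lemma iota0 : iota 0 = 0. Proof. by []. Qed.

Lemma iotaX a n : iota (a ^+ n) = iota a ^+ n.
Proof. by elim: n => [|n IH]; rewrite ?expr0 ?iota1 // !exprS iotaM IH. Qed.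

Lemma iota_sum n (F : 'I_n -> R) : iota (\sum_k F k) = \sum_k iota (F k).
Proof. by apply: (big_morph iota iotaD iota0). Qed.

Section LocMap.
Variables (U V : lmodType R) (f : {linear U -> V}).

Definition loc_map_fun (X : localization p U) : localization p V :=
  loc_frac (f (loc_num X)) (loc_den X).

Lemma loc_map_funE x s : loc_map_fun (loc_frac x s) = loc_frac (f x) s.
Proof.
have [u uE] := frac_num x s.
by apply/eq_frac; exists u; rewrite -!linearZZ uE.
Qed.

Lemma loc_map_linear : linear (loc_map_fun : localization p U -> localization p V).
Proof.
elim/frac_ind=> a s; elim/frac_ind=> x t; elim/frac_ind=> y w.
rewrite (locZE a x s t) (locDE (a *: x) y _ w) !loc_map_funE.
rewrite (locZE a (f x) s t) (locDE (a *: f x) (f y) _ w).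
by rewrite (linearD f) 3!(linearZZ f).
Qed.

Definition loc_map : {linear localization p U -> localization p V} :=
  mklin loc_map_linear.

Lemma loc_mapE x s : loc_map (loc_frac x s) = loc_frac (f x) s.
Proof. exact: loc_map_funE. Qed.
End LocMap.

Section LocComplex.
Variable C : complex R.

Lemma loc_diff_shape i j : j != i + 1 -> forall X, loc_map (diff C i j) X = 0.
Proof.
move=> ji; elim/frac_ind=> x s; rewrite loc_mapE diff_shape //.
by apply/loc_eq0; exists s; rewrite scaler0.
Qed.

Lemma loc_diff_comp i j k X : loc_map (diff C j k) (loc_map (diff C i j) X) = 0.
Proof.
elim/frac_ind: X => x s; rewrite !loc_mapE diff_comp.
by apply/loc_eq0; exists s; rewrite scaler0.
Qed.

Definition loc_complex : complex A := Complex loc_diff_shape loc_diff_comp.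

Lemma loc_exact i : exact_at C i -> exact_at loc_complex i.
Proof.
move=> ex i0 k iE kE; elim/frac_ind=> x s; rewrite /= loc_mapE.
move=> /loc_eq0[u]; rewrite -linearZZ => /(ex i0 k iE kE)[y yE].
by exists (loc_frac y (denomM u s)); rewrite /= loc_mapE yE loc_cancel.
Qed.
End LocComplex.

Lemma spanned_ext (I : {pred R}) n (g : 'I_n -> R) :
  spanned I g -> spanned (ext_ideal p I) (fun k => iota (g k)).
Proof.
move=> gP x; split=> [/asboolP[m [b [a [aI ->]]]]|[c ->]]; last first.
  apply/asboolP; exists n, c, g; split=> // k; exact: spanned_gen gP.
have [c cE] := choice (fun k => (gP _).1 (aI k)).
exists (fun j => \sum_k b k * iota (c k j)).
under [RHS]eq_bigr do rewrite mulr_suml.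
rewrite exchange_big; apply: eq_bigr => k _ /=.
rewrite -[loc_frac _ _]/(iota (a k)) cE iota_sum mulr_sumr.
by apply: eq_bigr => j _; rewrite iotaM mulrA.
Qed.

Lemma loc_torsion (I : {pred R}) n (g : 'I_n -> R) M (x : M) s :
  spanned I g -> x \in @torsion_pred R I M ->
  loc_frac x s \in @torsion_pred A (ext_ideal p I) (localization p M).
Proof.
move=> gP xT; apply: (torsion_spanned (spanned_ext gP)) => k.
have [e ge] := torsion_power xT (spanned_gen k gP).
exists e; rewrite -iotaX loc1_scale ge.
by apply/loc_eq0; exists s; rewrite scaler0.
Qed.

(** For each of the finitely many generators, a power kills the numerator up to a denominator.
    Multiplying the numerator by all these denominators makes it torsion over R. *)
Lemma torsion_loc (I : {pred R}) n (g : 'I_n -> R) M (X : localization p M) :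
  spanned I g -> X \in @torsion_pred A (ext_ideal p I) (localization p M) ->
  exists x s, x \in @torsion_pred R I M /\ X = loc_frac x s.
Proof.
move=> gP; elim/frac_ind: X => y s yT.
have uE k : exists q : nat * denom p, (dval q.2 * g k ^+ q.1) *: y = 0.
  have [e] := torsion_power yT (spanned_gen k (spanned_ext gP)).
  rewrite -iotaX loc1_scale => /loc_eq0[u].
  by rewrite scalerA => uy; exists (e, u).
have [q qE] := choice uE.
have vP : \prod_k dval (q k).2 \notin p.
  elim/big_ind: _ => [|a b pa pb|k _]; first by rewrite idealr1.
    by rewrite prime_idealrM negb_or pa.
  exact: valP (q k).2.
pose v : denom p := exist (fun r => r \notin p) _ vP.
have vE : dval v = \prod_k dval (q k).2 by [].
exists (dval v *: y), (denomM v s); split; last by rewrite loc_cancel.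
apply: (torsion_spanned gP) => k; exists (q k).1.
rewrite scalerA vE (bigD1 k) //= mulrCA mulrA mulrC -scalerA qE.
exact: scaler0.
Qed.

(** An ideal of R_p is generated by the image of its contraction to R. *)
Lemma noetherian_loc : noetherian R -> noetherian A.
Proof.
move=> noeth S.
have Psub : is_submod (fun a : R^o => (iota a : A^o) \in S).
  split.
  - exact: rpred0.
  - by move=> a b aS bS; rewrite iotaD; apply: rpredD.
  - move=> a b bS; rewrite -[_ *: b]/(a * b) iotaM; exact: (rpredZ (iota a)).
have [n [g gP]] := noeth (mksub Psub).
exists n, (fun k => (iota (g k) : A^o)) => X; split=> [|[c ->]].
  elim/frac_ind: X => a s aS.
  have : (iota a : A^o) \in S.
    by rewrite /iota -(loc_den_scale (a : R^o) s); apply: (rpredZ (iota _)).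
  move=> /(mksubP Psub)/gP[c aE].
  exists (fun k => inv_den s * iota (c k)).
  rewrite (loc_split (a : R^o)) -/(iota a) aE iota_sum.
  rewrite -[inv_den s *: _]/(inv_den s * _) mulr_sumr; apply: eq_bigr => k _.
  by rewrite -[_ *: _ in LHS]/(_ * _) iotaM mulrA.
apply: rpred_sum => k _; apply: rpredZ; apply/(mksubP Psub)/gP.
exists (fun j => (j == k)%:R).
rewrite (bigD1 k) //= eqxx scale1r big1 ?addr0 // => j /negPf ->; exact: scale0r.
Qed.
End LocalizationTheory.

(** * Localization of injective modules *)

Section LocalizedInjective.
Variables (R : comNzRingType) (p : prime_idealr R) (E : lmodType R).
Hypotheses (noeth : noetherian R) (injE : injective_module E).

Lemma denomX (s : denom p) n : exists u : denom p, dval u = dval s ^+ n.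
Proof.
elim: n => [|n [u uE]]; first by exists (denom1 p).
by exists (denomM s u); rewrite dvalM uE exprS.
Qed.

Lemma denom_prod n (u : 'I_n -> denom p) :
  exists v : denom p, dval v = \prod_k dval (u k).
Proof.
apply: (big_ind (fun a => exists v : denom p, dval v = a)).
- by exists (denom1 p).
- by move=> _ _ [v <-] [w <-]; exists (denomM v w).
- by move=> k _; exists (u k).
Qed.

Lemma mulr_linear (V : lmodType R) a (x : V) : linear (fun r : R^o => (a * r) *: x).
Proof. by move=> b r s; rewrite mulrDr scalerDl scalerA mulrCA. Qed.

(** The annihilators of the powers of s become stationary at some j, so s^(j+1) r |-> s^j r x is
    well defined on an ideal. If h extends it to R, then s^(j+1) h(1) = s^j x, that is, x / s = h(1)
    / 1. *)
Lemma loc_onto (X : localization p E) : exists y, X = loc_frac y (denom1 p).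
Proof.
elim/frac_ind: X => x s; pose B (j : nat) (r : R) := r * dval s ^+ j = 0.
have Bmono i j r : (i <= j)%N -> B i r -> B j r.
  by rewrite /B => ij ri; rewrite -(subnK ij) exprD mulrCA ri mulr0.
have [j|i j|j jP] := noetherian_chain (B := B) noeth (inhabits 0%N).
- split; rewrite /B; first by rewrite mul0r.
    by move=> a b ax bx; rewrite mulrDl ax bx addr0.
  by move=> a b bx; rewrite -mulrA bx mulr0.
- by have [ij|/ltnW ji] := leqP i j; [left|right] => a; apply: Bmono.
have [r|h hE] := inj_factor injE (f := mklin (mulr_linear (dval s ^+ j.+1) (1 : R^o)))
    (g := mklin (mulr_linear (dval s ^+ j) x)).
  rewrite !mklinE -[_ *: 1]/(_ * 1) mulr1 mulrC => /(jP j.+1).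
  by rewrite /B mulrC => ->; rewrite scale0r.
exists (h 1); have [u uE] := denomX s j.
have hx : dval s ^+ j.+1 *: h 1 = dval s ^+ j *: x.
  by have := hE 1; rewrite !mklinE !mulr1 linearZZ.
apply/eq_frac; exists u.
by rewrite uE dval1 mulr1 -hx exprSr.
Qed.

Definition den_torsion (x : E) : Prop := exists u : denom p, dval u *: x = 0.

Lemma den_torsion_submod : is_submod den_torsion.
Proof.
split; first by exists (denom1 p); rewrite scaler0.
  move=> x y [u ux] [v vy]; exists (denomM u v).
  by rewrite dvalM scalerDr mulrC -scalerA ux scaler0 add0r mulrC -scalerA vy scaler0.
by move=> a x [u ux]; exists u; rewrite scalerA mulrC -scalerA ux scaler0.
Qed.

(** It suffices that an essential extension of the torsion is torsion. For x in it, the ideal of all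
    r with r x torsion is finitely generated, so a single denominator v kills all these r x. A
    nonzero torsion multiple r v x would make r x torsion, hence r v x = 0; so v x = 0. *)
Lemma den_torsion_injective : injective_module (submod (mksub den_torsion_submod)).
Proof.
have [H [SH injH ess]] := inj_hull injE (mksub den_torsion_submod).
suff HS x : x \in H -> den_torsion x.
  have sH x : sub_val (mksub den_torsion_submod) x \in H by apply: SH; apply: valP x.
  have sS x : sub_val H x \in mksub den_torsion_submod.
    by apply/mksubP/HS; apply: valP x.
  by apply: (inj_retract (s := corestr sH) (r := corestr sS)) => // x; apply: val_inj.
move=> xH.
have Bsub : is_submod (fun r : R^o => den_torsion ((r : R) *: x)).
  have [T0 TD TZ] := den_torsion_submod; split; first by rewrite scale0r.
    by move=> a b; rewrite scalerDl; apply: TD.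
  by move=> a b bx; rewrite -[_ *: b]/(a * b) -scalerA; apply: TZ.
have [n [g gP]] := noeth (mksub Bsub).
have gB k : exists u : denom p, dval u *: ((g k : R) *: x) = 0.
  apply/(mksubP Bsub)/gP; exists (fun j => (j == k)%:R).
  rewrite (bigD1 k) //= eqxx scale1r big1 ?addr0 // => j /negPf ->; exact: scale0r.
have [u uE] := choice gB; have [v vE] := denom_prod u.
have vB r : den_torsion (r *: x) -> dval v *: (r *: x) = 0.
  move=> /(mksubP Bsub)/gP[c ->]; rewrite scaler_suml scaler_sumr big1 // => k _.
  rewrite -[_ *: g k]/(c k * (g k : R)) scalerA vE (bigD1 k) //=.
  set w := \prod_(i | _) _.
  have -> : dval (u k) * w * (c k * (g k : R)) = w * c k * (dval (u k) * (g k : R)).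
    by ring.
  by rewrite -scalerA -(scalerA (dval (u k))) uE scaler0.
exists v; apply: contrapT => vx.
have [|r /mksubP[w wrx] rx] := ess (dval v *: x) _ vx; first exact: rpredZ.
apply: rx; rewrite scalerA mulrC -scalerA; apply: vB.
by exists (denomM w v); rewrite dvalM -scalerA (scalerA (dval v)) [dval v * r]mulrC -scalerA.
Qed.

(** The kernel of E -> E_p is injective, hence a direct summand; as E -> E_p is onto, [sec]
    identifies E_p with a complement in E. Through [sec], a map from an ideal of R_p to E_p becomes
    a map from its contraction to E. This extends to R, and the value at 1 gives the element asked
    for by Baer's criterion. *)
Lemma loc_injective : injective_module (localization p E).
Proof.
apply: baer_injective => I g gI gfun g0 gD gM.
have [rho rhoE] := inj_extend den_torsion_injective (S := mksub den_torsion_submod) idfun.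
pose sec (y : E) : E := y - val (rho y).
have sec_eq y y' : loc_frac y (denom1 p) = loc_frac y' (denom1 p) -> sec y = sec y'.
  move=> /eqP; rewrite -subr_eq0 => /eqP yy'.
  have K : den_torsion (y - y').
    apply/(loc_eq0 _ (denom1 p)); rewrite -yy' -loc1D; congr (_ + _).
    exact/esym/loc_oppE.
  have KS : y - y' \in mksub den_torsion_submod by apply/mksubP.
  have := rhoE (exist _ (y - y') KS : submod _); rewrite linearB => /(congr1 val) /= rE.
  apply/eqP; rewrite -subr_eq0 /sec opprD opprK addrACA -rE.
  by rewrite addrACA subrr addNr addr0.
pose g' (a : R) (e : E) := exists y, g (iota p a) (loc_frac y (denom1 p)) /\ e = sec y.
have secP a y r y' : a *: sec y + r *: sec y' = sec (a *: y + r *: y').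
  rewrite /sec !linearD !linearZZ /=; exact: addrACA.
have g'fun a e e' : g' a e -> g' a e' -> e = e'.
  by move=> [y [gy ->]] [y' [gy' ->]]; apply/sec_eq/(gfun (iota p a)).
have g'lin r a e b e' : g' a e -> g' b e' -> g' (r * a + b) (r *: e + e').
  move=> [y [gy ->]] [y' [gy' ->]]; exists (r *: y + y'); split.
    by rewrite iotaD iotaM -loc1D -loc1_scale; apply: gD => //; apply: gM.
  by rewrite -[sec y']scale1r secP scale1r.
have g'0 : g' 0 0.
  by exists 0; split; [exact: g0 | rewrite /sec linear0 subr0].
have Isub : is_submod (fun a : R^o => exists e, g' a e).
  split; first by exists 0.
    move=> a b [e ge] [e' ge']; exists (1 *: e + e').
    by rewrite -[a]mul1r; apply: g'lin.
  by move=> r a [e ge]; exists (r *: e + 0); rewrite -[_ *: a]addr0; apply: g'lin.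
have FE (a : submod (mksub Isub)) : exists e, g' (val a) e.
  exact/(mksubP Isub)/(valP a).
have [F FP] := choice FE.
have Flin : linear F.
  move=> r a b; apply: (g'fun _ _ _ (FP _)).
  exact: (g'lin r _ _ _ _ (FP a) (FP b)).
have [h hE] := inj_extend injE (mklin Flin).
exists (loc_frac (h 1) (denom1 p)); elim/frac_ind => a s X _ gX.
apply/eqP; rewrite -subr_eq0; apply/eqP/(@iota_den_inj _ _ _ _ s).
have [y yE] := loc_onto (iota p (dval s) *: X).
have g'a : g' a (sec y).
  exists y; split=> //; rewrite -yE.
  by rewrite /iota -(loc_den_scale (a : R^o) s); apply: gM.
have aI : (a : R^o) \in mksub Isub by apply/mksubP; exists (sec y).
have ha : a *: h 1 = sec y.
  rewrite -linearZZ -[_ *: 1]/(a * 1) mulr1 (hE (exist _ (a : R^o) aI : submod _)) mklinE.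
  exact: (g'fun a _ _ (FP (exist _ (a : R^o) aI : submod _)) g'a).
rewrite scalerBr scalerA -[iota p (dval s) * _]/(iota p (dval s) *: (loc_frac (a : R^o) s)).
rewrite loc_den_scale -/(iota p a) loc1_scale ha yE.
have [u uy] : den_torsion (val (rho y)) by apply/(mksubP den_torsion_submod)/(valP (rho y)).
have ky : loc_frac (val (rho y)) (denom1 p) = 0 by apply/loc_eq0; exists u.
by rewrite -{1}[y](subrK (val (rho y))) -loc1D ky addr0 subrr.
Qed.
End LocalizedInjective.

(** * The natural map *)

Section NaturalMapCriterion.
Variables (A : comNzRingType) (n J : {pred A}) (N : lmodType A) (c : int).
Variables (r : nat) (g : 'I_r -> A).
Hypotheses (noeth : noetherian A) (gJ : spanned J g) (Jn : {subset J <= n}).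

Let E := Einj N.
Let D := Gamma_complex J E.
Let H := local_cohomology J c N.
Let L := Einj H.

Lemma Einj_injective (V : lmodType A) i : injective_module (Einj V i).
Proof. by have [[]] := Einj_minimal V. Qed.

Lemma Einj_neg (V : lmodType A) i : i < 0 -> is_zero (Einj V i).
Proof. by have [[_ + _ _ _] _] := Einj_minimal V; apply. Qed.

Lemma aug_inj (V : lmodType A) : injective (aug (Einj V)).
Proof. by have [[]] := Einj_minimal V. Qed.

Lemma aug_ker (V : lmodType A) (x : Einj V 0) :
  diff (Einj V) 0 1 x = 0 <-> exists v, aug (Einj V) v = x.
Proof. by have [[_ _ _ + _] _] := Einj_minimal V; apply. Qed.

Lemma Einj_exact (V : lmodType A) i : i != 0 -> exact_at (Einj V) i.
Proof.
move=> i0; have [[_ _ _ _ ex] _] := Einj_minimal V.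
have [ineg|ipos|iE] := ltgtP i 0; last by rewrite iE in i0.
  by move=> j k _ _ x _; exists 0; rewrite linear0 [RHS](Einj_neg ineg).
exact/cohomology_eq0/ex.
Qed.

Lemma Einj_bounded (V : lmodType A) : bounded_below (Einj V).
Proof. by exists 0 => i; apply: Einj_neg. Qed.

Lemma Gamma_injective_terms i : injective_module (D i).
Proof. exact: (Gamma_injective noeth gJ (@Einj_injective N i)). Qed.

Lemma Gamma_bounded : bounded_below D.
Proof. by exists 0 => i i0 x; apply: val_inj; apply: (Einj_neg i0). Qed.

(* This uses the minimality of the resolution: a nonzero torsion submodule of
   [E j] contains a nonzero cocycle. *)
Lemma Gamma_below :
  (forall j, j < c -> exact_at D j) -> forall j, j < c -> is_zero (D j).
Proof.
move=> ex.
suff main (k : nat) j : j < c -> j < k%:Z -> is_zero (D j).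
  by move=> j jc; apply: (main `|j|%N.+1) => //; lia.
elim: k j => [|k IH] j jc jk x.
  by apply: val_inj; apply: (Einj_neg jk).
apply/eqP; apply: contrapT => /negP x0.
have [_ ess] := Einj_minimal N.
have [|y [yT yZ /eqP[]]] := ess j (@torsion_pred A J (E j)).
  exists (val x); first exact: valP x.
  by apply: contra x0 => /eqP x0; apply/eqP; apply: val_inj.
have [|||w] := ex j jc (j - 1) (j + 1) _ _ (exist _ y yT : D j).
- by rewrite subrK.
- by [].
- by apply: val_inj => /=; apply/eqP.
rewrite [w](IH (j - 1)) ?linear0; [|lia|lia].
by move/(congr1 val).
Qed.

(** By [Gamma_below] there are no nonzero coboundaries in degree c, so sending a class to its
    cocycle is well defined. The comparison map then lifts this embedding to L. *)
Lemma embedding_lift_exists :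
  (forall j, j < c -> exact_at D j) -> lifts_embedding (embedding_lift J N c).
Proof.
move=> ex; rewrite /embedding_lift /choose_or; case: pselect => [e|[]].
  exact: projT2 (cid e).
have D0 := Gamma_below ex.
have b0 (x : submod (cocycles D c)) : x \in coboundaries D c ->
    sub_val (cocycles D c) x = 0.
  by move=> /asboolP[y yE]; rewrite /= mklinE -yE [y]D0 ?linear0 //; lia.
pose u := quot_lift b0 : {linear H -> D c}.
have [|||||h|phi phiE] := @comparison_map A L D c H (aug L) u.
- exact: aug_inj.
- by move=> x /aug_ker.
- exact: Einj_neg.
- by move=> i /lt0r_neq0; apply: Einj_exact.
- exact: Gamma_injective_terms.
- have [x ->] := quotmodP h; rewrite quot_liftE; exact/eqP/(valP x).
by exists phi => z; rewrite phiE quot_liftE.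
Qed.

Section Lift.
Variable phi : cmap c L D.
Hypothesis phiE : lifts_embedding phi.

(** L has cohomology in degree 0 only, where each cocycle is the augmentation of a class of H. The
    lift sends it to a representative of that class, so the class is zero if this representative is
    a coboundary. *)
Lemma lift_qinj i : qinj phi i.
Proof.
move=> i0 i1 j0 j i0E i1E jE j0E l y dl fl.
have [iE|i_neq0] := eqVneq i 0; last first.
  by have [l' l'E] := Einj_exact i_neq0 i0E i1E dl; exists l'.
have {}jE : j = c by lia.
have {}i1E : i1 = 1 by lia.
have {}i0E : i0 = -1 by lia.
have {}j0E : j0 = c - 1 by lia.
subst i0 i i1 j j0; have [h hE] := (aug_ker l).1 dl.
have [z zE] := quotmodP h.
suff -> : l = 0 by exists 0; rewrite linear0.
rewrite -hE (_ : h = 0) ?linear0 // zE; apply/cohomology_class0.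
by exists y; rewrite -fl -hE zE phiE.
Qed.

Lemma lift_qsurj i : exact_at D (i + c) \/ i = 0 -> qsurj phi i.
Proof.
move=> ex i1 j0 j j1 i1E jE j0E j1E x dx; case: ex => [ex|i0].
  subst j; have [y yE] := ex j0 j1 j0E j1E x dx.
  by exists 0, y; rewrite !linear0 add0r yE.
have {}jE : j = c by lia.
have {}i1E : i1 = 1 by lia.
have {}j1E : j1 = c + 1 by lia.
have {}j0E : j0 = c - 1 by lia.
subst i i1 j j1.
have xZ : x \in cocycles D c by rewrite in_ker dx.
pose z : submod (cocycles D c) := exist _ x xZ.
exists (aug L (quotmod_class (coboundaries D c) z)), 0; split.
  by apply/aug_ker; eexists.
by rewrite linear0 addr0 phiE.
Qed.
End Lift.

Lemma torsion_sub (V : lmodType A) (x : V) :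
  x \in @torsion_pred A n V -> x \in @torsion_pred A J V.
Proof.
case/asboolP => k xk; apply/asboolP; exists k => a aJ.
by apply: xk => l; apply: Jn.
Qed.

(** As J lies in n, [Gamma_n] of E and of [Gamma_J(E)] agree. This replaces the map into E that
    defines [natural_map] by the lift itself, whose target consists of J-torsion injectives. *)
Definition to_Gamma2 i (x : Gamma_complex n E i) : Gamma_complex n D i.
Proof.
exists (exist _ (val x) (torsion_sub (valP x))).
by case/asboolP: (valP x) => k xk; apply/asboolP; exists k => a an;
  apply: val_inj; apply: xk.
Defined.

Lemma of_Gamma2_proof i (x : Gamma_complex n D i) :
  val (val x) \in @torsion_pred A n (E i).
Proof.
case/asboolP: (valP x) => k xk; apply/asboolP; exists k => a an.
by have := congr1 val (xk a an).
Qed.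

Definition of_Gamma2 i (x : Gamma_complex n D i) : Gamma_complex n E i :=
  exist _ (val (val x)) (of_Gamma2_proof x).

Lemma incl_qsurj (phi : cmap c L D) i :
  qsurj (Gamma_cmap n (cmap_incl phi)) i <-> qsurj (Gamma_cmap n phi) i.
Proof.
split=> fS i1 j0 j j1 i1E jE j0E j1E x dx.
  have [|l [y [dl xE]]] := fS i1 j0 j j1 i1E jE j0E j1E (of_Gamma2 x).
    by apply: val_inj; have := congr1 val (congr1 val dx).
  exists l, (to_Gamma2 y); split=> //.
  by do 2!apply: val_inj; have := congr1 val xE.
have [|l [y [dl xE]]] := fS i1 j0 j j1 i1E jE j0E j1E (to_Gamma2 x).
  by do 2!apply: val_inj; have := congr1 val dx.
exists l, (of_Gamma2 y); split=> //.
by apply: val_inj; have := congr1 val (congr1 val xE).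
Qed.

Lemma incl_qinj (phi : cmap c L D) i :
  qinj (Gamma_cmap n (cmap_incl phi)) i <-> qinj (Gamma_cmap n phi) i.
Proof.
split=> fI i0 i1 j0 j i0E i1E jE j0E l y dl fl.
  apply: (fI i0 i1 j0 j i0E i1E jE j0E l (of_Gamma2 y) dl).
  by apply: val_inj; have := congr1 val (congr1 val fl).
apply: (fI i0 i1 j0 j i0E i1E jE j0E l (to_Gamma2 y) dl).
by do 2!apply: val_inj; have := congr1 val fl.
Qed.

Lemma natural_map_bijective :
  (forall j, j != c -> is_zero (local_cohomology J j N)) ->
  forall i, bijective (natural_map n J N c i).
Proof.
move=> H0 i.
have ex j : j != c -> exact_at D j by move=> jc; apply/cohomology_eq0/H0.
have phiE : lifts_embedding (embedding_lift J N c).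
  by apply: embedding_lift_exists => j jc; apply: ex; rewrite lt_eqF.
apply/bijective_cohomology_map.
have [fS fI] : qsurj (Gamma_cmap n (embedding_lift J N c)) i /\
    qinj (Gamma_cmap n (embedding_lift J N c)) i.
  apply: quasi_iso_Gamma.
  - by move=> k; apply: Einj_injective.
  - exact: Gamma_injective_terms.
  - exact: Einj_bounded.
  - exact: Gamma_bounded.
  - move=> k; apply: lift_qsurj => //.
    by have [->|k0] := eqVneq k 0; [right | left; apply: ex; lia].
  - by move=> k; apply: lift_qinj.
by split; [apply/incl_qsurj | apply/incl_qinj].
Qed.

(* The class of [z] lives in the cone of the lift, in degree [k - c], which is
   exact below; the contraction of the cone corrects [z] to an [n]-torsion
   cocycle, which is a boundary as the [n]-torsion of the cone is exact. *)
Lemma natural_map_lowest (k : int) (z : D k) :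
  (forall j, j < k -> j != c -> is_zero (local_cohomology J j N)) -> c < k ->
  (forall i, bijective (natural_map n J N c i)) ->
  diff D k (k + 1) z = 0 ->
  (forall a, a \in n -> exists w, diff D (k - 1) k w = a *: z) ->
  exists w, diff D (k - 1) k w = z.
Proof.
move=> H0 ck bij dz nz.
have ex j : j < k -> j != c -> exact_at D j.
  by move=> jk jc; apply/cohomology_eq0/H0.
have phiE : lifts_embedding (embedding_lift J N c).
  by apply: embedding_lift_exists => j jc; apply: ex; lia.
set phi := embedding_lift J N c in phiE.
have injC i : injective_module (cone phi i).
  by apply: cone_injective => j; [apply: Einj_injective | apply: Gamma_injective_terms].
have Cb : bounded_below (cone phi).
  by apply: cone_bounded_below; [exact: Einj_bounded | exact: Gamma_bounded].
have [i kE] : exists i, k = i + 1 + c by exists (k - c - 1); lia.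
have k1 : k - 1 = i + c by lia.
have k2 : k + 1 = i + 1 + 1 + c by lia.
rewrite k1 in nz *; rewrite k2 in dz; subst k.
have [||h hE] := @contraction _ (cone phi) i (i + 1) injC Cb.
- by [].
- move=> j ji; apply: cone_exact; last exact: lift_qinj.
  apply: lift_qsurj => //.
  by have [->|j0] := eqVneq j 0; [right | left; apply: ex; lia].
(* By the long exact sequence this takes (ii) in two degrees: surjectivity in degree i + 1 and
   injectivity in degree i + 2. *)
have exG : exact_at (Gamma_complex n (cone phi)) (i + 1).
  apply/cone_Gamma_exact/cone_exact; have := bij (i + 1 + 1); have := bij (i + 1).
    by move=> /bijective_cohomology_map[/incl_qsurj].
  by move=> _ /bijective_cohomology_map[_ /incl_qinj].
pose x : cone phi (i + 1) := (0, z).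
have dx : diff (cone phi) (i + 1) (i + 1 + 1) x = 0.
  by rewrite /= mklinE /cone_fun /= dz !linear0 addr0.
pose x' := x - diff (cone phi) i (i + 1) (h x).
have x'T : x' \in @torsion_pred A n (cone phi (i + 1)).
  (* For a in n, the multiple a x is a boundary of the cone, so d h (a x) = a x and a kills x'. *)
  apply/asboolP; exists 1%N => a an; rewrite big_ord1.
  have [w wE] := nz _ (an ord0).
  have axE : a ord0 *: x = diff (cone phi) i (i + 1) (0, w).
    by rewrite /= mklinE /cone_fun /= !linear0 add0r wE; congr (_, _); apply: scaler0.
  by rewrite scalerBr -!linearZZ axE hE subrr.
have [|||y yE] := exG i (i + 1 + 1) _ _ (exist _ x' x'T).
- by [].
- by [].
- by apply: val_inj; rewrite /= /x' linearB /= dx cone_comp subr0.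
have {yE} : diff (cone phi) i (i + 1) (val y + h x) = x.
  have {}yE : diff (cone phi) i (i + 1) (val y) = x' := congr1 val yE.
  by rewrite linearD yE subrK.
case: (val y + h x) => l w; rewrite /= mklinE /cone_fun /= => -[/eqP].
rewrite oppr_eq0 => /eqP dl <-.
(* In components, (0, z) = d (l, w) says that l is a cocycle and z = phi l + d w. Since c < k, the
   degree i + 1 of l is positive, so l is a coboundary and so is phi l. *)
have i1 : i + 1 != 0 by lia.
have [l' <-] := Einj_exact i1 erefl erefl dl.
exists (phi i (i + c) l' + w); rewrite linearD; congr (_ + _).
have ic : i + 1 + c = i + c + 1 by lia.
exact/esym/(cmap_commE phi l' erefl erefl ic).
Qed.
End NaturalMapCriterion.

Definition mkGamma (R : comNzRingType) (J : {pred R}) (V : lmodType R) (x : V)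
  (xT : x \in @torsion_pred R J V) : Gamma J V := exist _ x xT.

(** * Local cohomology under localization *)

Section LocalCohomologyLocalization.
Variables (R : comNzRingType) (M : lmodType R) (I : idealr R) (p : prime_idealr R).
Hypothesis noeth : noetherian R.

Let E := Einj M.
Let N := localization p M.
Let F := Einj N.
Let J := ext_ideal p I.
Let Ep := loc_complex p E.

Lemma loc_zero (V : lmodType R) : is_zero V -> is_zero (localization p V).
Proof.
move=> V0; elim/frac_ind=> x s; apply/loc_eq0.
by exists s; rewrite [x]V0 scaler0.
Qed.

Lemma loc_aug_cocycle (X : Ep 0) :
  diff Ep 0 1 X = 0 <-> exists m, loc_map p (aug E) m = X.
Proof.
split=> [|[m <-]].
  elim/frac_ind: X => x s; rewrite /= loc_mapE => /loc_eq0[u].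
  rewrite -linearZZ => /aug_ker[m mE].
  by exists (loc_frac m (denomM u s)); rewrite loc_mapE mE loc_cancel.
elim/frac_ind: m => m s; rewrite loc_mapE.
have dm : diff E 0 1 (aug E m) = 0 by apply/aug_ker; exists m.
rewrite -[LHS]/(loc_map p (diff E 0 1) _) loc_mapE dm.
by apply/loc_eq0; exists s; rewrite scaler0.
Qed.

Lemma loc_aug_inj : injective (loc_map p (aug E)).
Proof.
apply: inj_of_ker0; elim/frac_ind=> m s; rewrite loc_mapE => /loc_eq0[u].
rewrite -linearZZ -(linear0 (aug E)) => /(@aug_inj _ M) um.
by apply/loc_eq0; exists u.
Qed.

(** F and the localized resolution of M are both injective resolutions of M_p, and a comparison map
    between them is a quasi-isomorphism of bounded below complexes of injectives. This avoids
    proving that localization preserves minimality. *)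
Lemma loc_comparison : exists f : cmap 0 F Ep,
  forall i, qsurj (Gamma_cmap J f) i /\ qinj (Gamma_cmap J f) i.
Proof.
have [|||||h|f fE] := @comparison_map _ F Ep 0 N (aug F) (loc_map p (aug E)).
- exact: aug_inj.
- by move=> x /aug_ker.
- exact: Einj_neg.
- by move=> i /lt0r_neq0; apply: Einj_exact.
- by move=> i; apply: (loc_injective noeth (@Einj_injective _ M i)).
- by apply/loc_aug_cocycle; exists h.
have Ep_ex i : i != 0 -> exact_at Ep i by move=> i0; apply/loc_exact/Einj_exact.
exists f; apply: quasi_iso_Gamma.
- exact: Einj_injective.
- by move=> i; apply: (loc_injective noeth (@Einj_injective _ M i)).
- exact: Einj_bounded.
- by exists 0 => i i0; apply/loc_zero/Einj_neg.
- move=> i i1 j0 j j1 i1E jE j0E j1E x dx.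
  have {jE}iE : i = j by lia.
  subst i; have [jE|jn0] := eqVneq j 0; last first.
    have [y yE] := Ep_ex j jn0 j0 j1 j0E j1E x dx.
    by exists 0, y; rewrite !linear0 add0r yE.
  have {}i1E : i1 = 1 by lia.
  have {}j1E : j1 = 1 by lia.
  have {}j0E : j0 = -1 by lia.
  subst j i1 j1 j0; have [m mE] := (loc_aug_cocycle x).1 dx.
  exists (aug F m), 0; split; first by apply/aug_ker; exists m.
  by rewrite linear0 addr0 fE mE.
- move=> i i0 i1 j0 j i0E i1E jE j0E l y dl fl.
  have [iE|i_neq0] := eqVneq i 0; last first.
    by have [l' l'E] := Einj_exact i_neq0 i0E i1E dl; exists l'.
  have {}jE : j = 0 by lia.
  have {}i1E : i1 = 1 by lia.
  have {}i0E : i0 = -1 by lia.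
  have {}j0E : j0 = -1 by lia.
  subst i0 i i1 j j0; have [m mE] := (aug_ker l).1 dl.
  exists 0; rewrite linear0 -mE (_ : m = 0) ?linear0 //.
  apply: loc_aug_inj; rewrite linear0 -fE mE fl.
  by rewrite [y](loc_zero (@Einj_neg _ M (-1) isT)) linear0.
Qed.

Variables (r : nat) (g : 'I_r -> R).
Hypothesis gI : spanned I g.

Lemma Gamma_loc_exact i :
  exact_at (Gamma_complex I E) i -> exact_at (Gamma_complex J Ep) i.
Proof.
move=> ex i0 k iE kE [X XT] /(congr1 val) /= dX.
have [x [s [xT XE]]] := torsion_loc gI XT.
have [u] : exists u : denom p, dval u *: diff E i k x = 0.
  by apply/(loc_eq0 _ s); rewrite -loc_mapE -XE.
rewrite -linearZZ => dux.
have uxT : dval u *: x \in @torsion_pred R I (E i) by apply: rpredZ.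
have [|[w wT] /(congr1 val) /= wE] := ex i0 k iE kE (mkGamma uxT).
  exact: val_inj.
exists (mkGamma (loc_torsion (denomM u s) gI wT)).
by apply: val_inj; rewrite /= XE loc_mapE wE loc_cancel.
Qed.

Lemma local_cohomology_loc0 i :
  is_zero (local_cohomology I i M) -> is_zero (local_cohomology J i N).
Proof.
move=> /cohomology_eq0 ex; apply/cohomology_eq0 => i0 k iE kE l dl.
have [f /(_ i)[_ fI]] := loc_comparison.
have i1 : i + 0 = i by exact: addr0.
have [|y yE] := Gamma_loc_exact ex iE kE (x := Gamma_cmap J f i i l).
  by rewrite -(@cmap_commE _ _ _ _ _ i i k k) ?dl ?linear0 //; lia.
have [|l' l'E] := fI i0 k i0 i iE kE (esym i1) iE l y dl; first by rewrite yE.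
by exists l'.
Qed.

(** The hypothesis says that p is the annihilator of the class of x. Its localization is thus killed
    by the extension of p and nonzero, and the quasi-isomorphism of [loc_comparison] carries it to a
    class in the chosen resolution of M_p. *)
Lemma socle_loc i (x : Gamma_complex I E i) :
  diff (Gamma_complex I E) i (i + 1) x = 0 ->
  (forall a, a \in p <->
     exists w, diff (Gamma_complex I E) (i - 1) i w = a *: x) ->
  exists z : Gamma_complex J F i,
    [/\ diff (Gamma_complex J F) i (i + 1) z = 0,
        ~ (exists w, diff (Gamma_complex J F) (i - 1) i w = z) &
        forall a, a \in ext_ideal p p ->
          exists w, diff (Gamma_complex J F) (i - 1) i w = a *: z].
Proof.
move=> dx xp; have [f /(_ i)[fS fI]] := loc_comparison.
have i0 : i = i + 0 by rewrite addr0.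
have im : i = i - 1 + 1 by rewrite subrK.
pose X : Gamma_complex J Ep i :=
  mkGamma (loc_torsion (denom1 p) gI (valP x)).
have dX : diff (Gamma_complex J Ep) i (i + 1) X = 0.
  apply: val_inj; rewrite /= loc_mapE; have /= -> := congr1 val dx.
  by apply/loc_eq0; exists (denom1 p); rewrite scaler0.
have [z [y [dz XE]]] := fS _ _ _ _ erefl i0 im erefl X dX.
have fd w : Gamma_cmap J f i i (diff (Gamma_complex J F) (i - 1) i w) =
    diff (Gamma_complex J Ep) (i - 1) i (Gamma_cmap J f (i - 1) (i - 1) w).
  by apply: cmap_commE; lia.
exists z; split=> //.
- move=> [w wE].
  have [W WE] : exists W, diff (Gamma_complex J Ep) (i - 1) i W = X.
    by exists (Gamma_cmap J f (i - 1) (i - 1) w + y); rewrite linearD -fd wE XE.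
  have [v [t [vT vE]]] := torsion_loc (X := sval W) gI (valP W).
  move/(congr1 val): WE; rewrite /= vE loc_mapE => /eq_frac[u].
  rewrite dval1 mulr1 => uE.
  (* If x / 1 bounds v / t, then u t x is the boundary of u v for some denominator u, so u t
     annihilates the class of x. *)
  have : dval (denomM u t) \in p; last by apply/negP/(valP (denomM u t)).
  apply/xp; exists (dval u *: (mkGamma vT : Gamma_complex I E (i - 1))).
  by apply: val_inj; rewrite dvalM linearZZ /= uE.
- have pz a : a \in p ->
      exists w, diff (Gamma_complex J F) (i - 1) i w = iota p a *: z.
    move=> /xp[w wE].
    pose W : Gamma_complex J Ep (i - 1) :=
      mkGamma (loc_torsion (denom1 p) gI (valP w)).
    have WE : diff (Gamma_complex J Ep) (i - 1) i W = iota p a *: X.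
      by apply: val_inj; rewrite /= loc_mapE loc1_scale; have /= -> := congr1 val wE.
    have [||l lE] := fI _ _ _ _ im erefl i0 im (iota p a *: z) (W - iota p a *: y).
    + by rewrite linearZZ dz scaler0.
    + rewrite (linearZZ (Gamma_cmap J f i i)) (linearB (diff _ (i - 1) i)) WE.
      by rewrite (linearZZ (diff _ (i - 1) i)) XE scalerDr addrK.
    by exists l.
  move=> a /asboolP[m [b [q [qp ->]]]].
  have [w wE] := choice (fun k => pz _ (qp k)).
  exists (\sum_k b k *: w k); rewrite linear_sum scaler_suml.
  by apply: eq_bigr => k _; rewrite linearZZ wE scalerA.
Qed.
End LocalCohomologyLocalization.

(** * Vanishing below the grade and the equivalence of (i) and (ii) *)

Lemma grade_le (R : comNzRingType) (I : {pred R}) (M : lmodType R) (i : int) :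
  i < grade I M -> is_zero (local_cohomology I i M).
Proof.
rewrite /grade /choose_or; case: pselect => [ex|_].
  case: (cid ex) => c /= [_ cmin] ic; apply: contrapT => Hi.
  by have := cmin i Hi; rewrite leNgt ic.
(* When the choice falls back on its default, the grade is 0, and the resolution is zero in negative
   degrees. *)
move=> ineg; apply/cohomology_eq0 => j k _ _ x _; exists 0.
by rewrite linear0; apply: val_inj; rewrite [RHS](Einj_neg ineg).
Qed.

Lemma prime_idealX (R : comNzRingType) (p : prime_idealr R) a n :
  a ^+ n \in p -> a \in p.
Proof.
elim: n => [|n IH]; first by rewrite expr0 idealr1.
by rewrite exprS prime_idealrM => /orP[].
Qed.

Lemma ext_ideal_sub (R : comNzRingType) (p : prime_idealr R) (I : idealr R) :
  {subset I <= p} -> {subset ext_ideal p I <= ext_ideal p p}.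
Proof.
move=> Ip x /asboolP[n [b [a [aI ->]]]]; apply/asboolP.
by exists n, b, a; split=> // k; apply: Ip.
Qed.

Theorem theorem4p4 (R : comNzRingType) (m : idealr R) (M : lmodType R)
    (I : idealr R) :
  noetherian R -> local_ring m ->
  finitely_generated M -> ~ is_zero M ->
  let c := grade I M in
  (forall i : int, i != c -> is_zero (local_cohomology I i M))
  <->
  (forall p : prime_idealr R, {subset I <= p} -> in_supp M p ->
   forall i : int,
     bijective (natural_map (ext_ideal p p) (ext_ideal p I)
                  (localization p M) c i)).
Proof.
move=> noeth _ _ _ c; have [r [g gI]] := noetherian_spanned I noeth.
split=> [H0 p Ip _|bij].
  apply: (natural_map_bijective (noetherian_loc noeth) (spanned_ext gI)).
    exact: ext_ideal_sub.
  by move=> j jc; apply: (local_cohomology_loc0 noeth gI); apply: H0.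
(* Below c the vanishing is [grade_le]; the degrees above c are treated by strong induction on k. *)
suff main (k : nat) : is_zero (local_cohomology I (c + k.+1%:Z) M).
  move=> i ic; have [/grade_le//|ci|iE] := ltgtP i c; last by rewrite iE eqxx in ic.
  have -> : i = c + (`|i - c|%N.-1).+1%:Z by lia.
  exact: main.
have [k0] := ubnP k; elim: k0 k => // k0 IH k kk0.
set i := c + k.+1%:Z; apply: contrapT => Hi.
have below j : j < i -> j != c -> is_zero (local_cohomology I j M).
  move=> ji jc; have [/grade_le//|cj|jE] := ltgtP j c; last by rewrite jE eqxx in jc.
  have -> : j = c + (`|j - c|%N.-1).+1%:Z by lia.
  by apply: IH; lia.
have [X [p [X0 pX]]] := associated_prime noeth Hi.
have [x xE] := quotmodP X.
have xp a : a \in p <->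
    exists w, diff (Gamma_complex I (Einj M)) (i - 1) i w = a *: val x.
  rewrite pX xE -(linearZZ (quotmod_class (coboundaries _ i))).
  by rewrite cohomology_class0 sub_valZ.
have dx : diff (Gamma_complex I (Einj M)) i (i + 1) (val x) = 0 by exact/eqP/(valP x).
(* The class X has an I-torsion representative, so some power of each element of I annihilates X and
   lies in p. *)
have Ip : {subset I <= p}.
  move=> a aI; have [e ex] := torsion_power (valP (val x)) aI.
  apply: (@prime_idealX _ p a e); apply/xp; exists 0; rewrite linear0.
  by apply: val_inj; rewrite /= ex.
have [z [dz zn pz]] := socle_loc noeth gI dx xp.
(* If M_p were zero, its resolution would be an exact bounded below complex of injectives, hence
   exact after taking torsion, and z would be a coboundary. *)
have supp : in_supp M p.
  move=> N0; apply: zn.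
  have ex : forall j, exact_at (Gamma_complex (ext_ideal p I) (Einj (localization p M))) j.
    apply: Gamma_exact; [exact: Einj_injective | exact: Einj_bounded | move=> j].
    have [->|] := eqVneq j 0; last exact: Einj_exact.
    move=> j0 j1 _ /[!add0r] -> y /aug_ker[v <-]; exists 0.
    by rewrite linear0 [v]N0 linear0.
  by apply: (ex i) dz; rewrite ?subrK.
apply: zn.
apply: (natural_map_lowest (noetherian_loc noeth) (spanned_ext gI)
  (ext_ideal_sub Ip) _ _ (bij p Ip supp) dz pz).
  by move=> j ji jc; apply: (local_cohomology_loc0 noeth gI); apply: below.
by rewrite /i; lia.
Qed.
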